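(* Consider the tabular softmax policy class $\hat\pi_\theta(a|s)\propto\exp(\theta(s,a))$, $\theta\in\mathbb R^{|\mathcal S|\times|\mathcal A|}$, in the discrete setting, and let $i\in\{1,2\}$. Suppose that (A1) $|A_\tau^{\hat\pi_\theta}(s,a)|\le A_{max}$ for every task $\tau\in\Gamma$, every softmax policy $\hat\pi_\theta$ and all $s\in\mathcal S,a\in\mathcal A$; and (A2) for every task $\tau\in\Gamma$ there is a constant $\epsilon>0$ such that for all bounded parameters $\phi$, $\nu_\tau^{\hat\pi_\phi}(s)\ge\epsilon$ for all $s\in\mathcal S$. Let $\{\phi_t\}_{t=1}^T$ be the meta-parameters generated by the meta-training algorithm with within-task algorithm $\mathcal Alg^{(i)}$, $\lambda\ge2A_{max}$ and step size $$\alpha=\min\Big\{\Big(\frac{r_{max}B_i}{(1-\gamma)^2}+\frac{2\gamma r_{max}C_i^2}{(1-\gamma)^3}\Big)^{-1},\ \frac{1}{G_i\sqrt T}\Big\}.$$ Then $$\frac1T\sum_{t=1}^T\mathbb E\Big[\big\|\nabla_\phi\mathbb E_{\tau\sim\mathbb P(\Gamma)}[J_\tau(\mathcal Alg^{(i)}(\hat\pi_{\phi_t},\lambda,\tau))]\big\|^2\Big]\le\frac{K_i}{T}+\frac{M_i}{\sqrt T},$$ where the first expectation is over the random task sampling of the algorithm, and $B_1=\frac{16r_{max}}{\lambda(1-\gamma)^3}+\frac{24}{1-\gamma}+\frac{12}{\lambda}$, $C_1=\frac{6}{1-\gamma}$, $G_1=\frac{4A_{max}}{(1-\gamma)^2}$;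 $B_2=\frac{16r_{max}}{\lambda(1-\gamma)^3}+\frac{18}{(1-\gamma)^2}$, $C_2=\frac{4}{1-\gamma}$, $G_2=\frac{2A_{max}}{(1-\gamma)^2}$; $K_i=\frac{2(B_i+2C_i^2)r_{max}^2}{(1-\gamma)^4}$, $M_i=\frac{(B_i+2C_i^2)G_ir_{max}}{(1-\gamma)^4}$.
   Context: Each task $\tau\in\Gamma$ is an MDP $(\mathcal S,\mathcal A,\gamma,\rho_\tau,P_\tau,r_\tau)$ with state space $\mathcal S$, action space $\mathcal A$ (both common to all tasks), discount factor $\gamma\in(0,1)$, initial state distribution $\rho_\tau$, transition probability $P_\tau(s'|s,a)$, and reward $r_\tau:\mathcal S\times\mathcal A\times\mathcal S\to[0,r_{max}]$. Tasks follow a probability distribution $\mathbb P(\Gamma)$. For a policy $\pi$: $V_\tau^\pi(s)=\mathbb E[\sum_{t\ge0}\gamma^tr_\tau(s_t,a_t,s_{t+1})|s_0=s,\pi]$, $Q_\tau^\pi(s,a)$ is the same with also $a_0=a$, $A_\tau^\pi=Q_\tau^\pi-V_\tau^\pi$, $J_\tau(\pi)=\mathbb E_{s\sim\rho_\tau}[V_\tau^\pi(s)]$, and $\nu_\tau^\pi(s)=(1-\gamma)\sum_{t\ge0}\gamma^t\mathbb P(s_t=s|\pi,s_0\sim\rho_\tau)$. Distances: $d_1^2(\pi,\pi',s)=D_{KL}(\pi(\cdot|s)\|\pi'(\cdot|s))$ and $d_2^2(\pi,\pi',s)=D_{KL}(\pi'(\cdot|s)\|\pi(\cdot|s))$. Within-task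 algorithm: $\mathcal Alg^{(i)}(\hat\pi_\phi,\lambda,\tau)$ is the policy whose value at each $s$ is $\operatorname{argmax}_{\pi(\cdot|s)}\sum_{a}\pi(a|s)Q_\tau^{\hat\pi_\phi}(s,a)-\lambda d_i^2(\hat\pi_\phi,\pi,s)$ over probability distributions $\pi(\cdot|s)$ on $\mathcal A$. Meta-training algorithm: starting from an initial $\phi_0$, at each iteration $t$ draw $\tau\sim\mathbb P(\Gamma)$ i.i.d., and set $\phi_{t+1}=\phi_t+\alpha\nabla_\phi J_\tau(\mathcal Alg^{(i)}(\hat\pi_\phi,\lambda,\tau))|_{\phi=\phi_t}$. *)

(* Defs.v *)
From HB Require Import structures.
From mathcomp Require Import all_boot all_order all_algebra.
From mathcomp Require Import all_classical all_reals all_analysis.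
From mathcomp Require Import lra.

Set Implicit Arguments.
Unset Strict Implicit.
Unset Printing Implicit Defensive.

Import Order.TTheory GRing.Theory Num.Theory.
Import numFieldNormedType.Exports.

Local Open Scope classical_set_scope.
Local Open Scope ring_scope.

(* Nonempty finite types. *)
#[short(type=finPointedType)]
HB.structure Definition FinPointed := {T of Finite T & Pointed T}.
HB.instance Definition _ (X Y : finPointedType) := Pointed.on (X * Y)%type.

Definition is_dist (R : realType) (X : finType) (p : X -> R) : Prop :=
  (forall x, 0 <= p x) /\ \sum_x p x = 1.

Section MarkovLaw.
Context {R : realType} {X : finPointedType}.

Definition coordinate_sets : set (set (nat -> X)) :=
  [set [set w | w k = x] | k in [set: nat] & x in [set: X]].

(* Sequences in [X] with the product sigma-algebra. *)
Definition path_space := g_sigma_algebraType coordinate_sets.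

Definition is_markov_law (q0 : X -> R) (K : X -> X -> R)
    (m : probability path_space R) : Prop :=
  forall (n : nat) (x : nat -> X),
    m [set w : nat -> X | forall k, (k <= n)%N -> w k = x k] =
    (q0 (x 0%N) * \prod_(k < n) K (x k) (x k.+1))%:E.

(* The choice is meaningful by [markov_lawP] below, and unambiguous because the
   sets constrained by [is_markov_law] are a generating pi-system (together with
   the empty set). *)
Definition markov_law (q0 : X -> R) (K : X -> X -> R) :
    probability path_space R :=
  get (is_markov_law q0 K).

Section existence.
Variables (q0 : X -> R) (K : X -> X -> R).
Hypotheses (q0d : is_dist q0) (Kd : forall x, is_dist (K x)).

(* Histories are listed with the most recent point first; each history [h] gets
   a half-open subinterval of [0, 1) of length the probability of [h]. *)
Let nxt (h : seq X) : X -> R := if h is x :: _ then K x else q0.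
Let nxt_dist h : is_dist (nxt h).
Proof. by case: h => [|x h]; [exact: q0d | exact: Kd]. Qed.

Let rk (x : X) : nat := @enum_rank X x.
Let rk_inj : injective rk.
Proof. by move=> x y /val_inj /enum_rank_inj. Qed.

Let before h x : R := \sum_(y | (rk y < rk x)%N) nxt h y.

Let wt := fix wt h : R := if h is x :: h' then wt h' * nxt h' x else 1.
Let lo := fix lo h : R := if h is x :: h' then lo h' + wt h' * before h' x else 0.
Let inC h (u : R) : bool := (lo h <= u) && (u < lo h + wt h).

Let wt_ge0 h : 0 <= wt h.
Proof. by elim: h => //= x h IH; rewrite mulr_ge0 //; exact: (nxt_dist h).1. Qed.

Let beforeS h x y : (rk x < rk y)%N ->
  before h x + nxt h x <= before h y.
Proof.
move=> xy; rewrite /before [leRHS](bigD1 x) //= [leLHS]addrC lerD2l.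
rewrite [leRHS](bigID (fun z => (rk z < rk x)%N)) /=.
rewrite [X in _ <= X + _](_ : _ = before h x).
  by rewrite lerDl sumr_ge0 // => z _; case: (nxt_dist h).
apply: eq_bigl => z; case: (ltnP (rk z) (rk x)) => zx; last by rewrite andbF.
by rewrite (ltn_trans zx xy) andbT /=; apply: contraTneq zx => ->; rewrite ltnn.
Qed.

Let before_le1 h x : before h x + nxt h x <= 1.
Proof.
have [h0 <-] := nxt_dist h.
rewrite /before (bigD1 (P := predT) x) //= [leLHS]addrC lerD2l.
rewrite [leRHS](bigID (fun z => (rk z < rk x)%N)) /=.
rewrite [X in _ <= X + _](_ : _ = before h x).
  by rewrite lerDl sumr_ge0.
apply: eq_bigl => z; case: (ltnP (rk z) (rk x)) => zx; last by rewrite andbF.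
by rewrite andbT /=; apply: contraTneq zx => ->; rewrite ltnn.
Qed.

Let inC_cons x h u : inC (x :: h) u -> inC h u.
Proof.
have w0 := wt_ge0 h; have b1 := before_le1 h x.
have b0 : 0 <= before h x by rewrite sumr_ge0 // => z _; case: (nxt_dist h).
have wb0 := mulr_ge0 w0 b0.
have := ler_wpM2l w0 b1; rewrite mulrDr mulr1.
by rewrite /inC /= => H /andP[? ?]; apply/andP; split; lra.
Qed.

Let inC_inj x y h u : inC (x :: h) u -> inC (y :: h) u -> x = y.
Proof.
have w0 := wt_ge0 h.
wlog xy : x y / (rk x < rk y)%N.
  move=> W Hx Hy; case: (ltngtP (rk x) (rk y)) => xy.
  - exact: W.
  - by apply/esym; exact: W.
  - exact/rk_inj.
have := ler_wpM2l w0 (beforeS h xy); rewrite mulrDr.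
by rewrite /inC /= => ? /andP[? ?] /andP[? ?]; exfalso; lra.
Qed.

Let inC_ex h u : inC h u -> exists x, inC (x :: h) u.
Proof.
move=> /andP[hl hu].
have [h0 h1] := nxt_dist h.
pose good x := u < lo h + wt h * (before h x + nxt h x).
have [z gz] : exists z, good z.
  case: (@arg_maxnP X point predT (rk) isT) => z _ zmax.
  exists z; rewrite /good (_ : before h z + _ = 1) ?mulr1 //.
  rewrite -h1 (bigD1 (P := predT) z) //= addrC; congr (_ + _).
  apply: eq_bigl => y; have := zmax y isT.
  by rewrite -(inj_eq rk_inj) /=; case: ltngtP.
case: (@arg_minnP X z good (rk) gz) => x gx xmin.
exists x; rewrite /inC /= -addrA -mulrDr (gx : (u < _) = true) andbT.
case: (posnP (rk x)) => [x0|xgt0].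
  by rewrite /before big_pred0 ?mulr0 ?addr0 // => y; rewrite x0.
have lt : ((rk x).-1 < #|X|)%N.
  by rewrite (leq_ltn_trans (leq_pred _)) // ltn_ord.
pose y : X := enum_val (Ordinal lt).
have ry : rk y = (rk x).-1 by rewrite /rk enum_valK.
have -> : before h x = before h y + nxt h y.
  rewrite /before (bigD1 y) /= ?ry ?prednK // addrC; congr (_ + _).
  apply: eq_bigl => w; rewrite -(inj_eq rk_inj) ry.
  by rewrite -{1}(prednK xgt0) ltnS [RHS]ltn_neqAle andbC.
rewrite leNgt; apply/negP => /xmin; rewrite ry.
by rewrite -{1}(prednK xgt0) ltnn.
Qed.

Let hist := fix hist n (u : R) : seq X :=
  if n is n'.+1 then
    odflt point [pick x | inC (x :: hist n' u) u] :: hist n' u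
  else [::].

Let inC_nil u : inC [::] u = (0 <= u < 1).
Proof. by rewrite /inC /= add0r. Qed.

Let hist_inC n u : 0 <= u < 1 -> inC (hist n u) u.
Proof.
move=> u01; elim: n => [|n IH] /=; first by rewrite inC_nil.
case: pickP => [x //|none]; have [x] := inC_ex IH.
by rewrite none.
Qed.

Let inC01 h u : inC h u -> 0 <= u < 1.
Proof.
by elim: h => [|x h IH]; [rewrite inC_nil | move=> /inC_cons].
Qed.

Let histE h u : 0 <= u < 1 -> (hist (size h) u == h) = inC h u.
Proof.
move=> u01; apply/eqP/idP => [<-|]; first exact: hist_inC.
elim: h => //= x h IH Hx; have hu := IH (inC_cons Hx); rewrite hu.
case: pickP => [y /= Hy|/(_ x)]; last by rewrite Hx.
by rewrite (inC_inj Hx Hy).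
Qed.

Let size_hist n u : size (hist n u) = n.
Proof. by elim: n => //= n ->. Qed.

Let traj : measurableTypeR R -> path_space :=
  fun u k => head point (hist k.+1 u).

Let hist_out n u : (0 <= u < 1) = false -> hist n u = nseq n point.
Proof.
move=> u01; elim: n => //= n ->; congr (_ :: _).
by case: pickP => // x /inC01; rewrite u01.
Qed.

Let CE h : [set u | inC h u] = `[lo h, lo h + wt h[%classic.
Proof. by apply/seteqP; split=> u; rewrite /= in_itv. Qed.

Let mC h : measurable ([set u | inC h u] : set R).
Proof. by rewrite CE. Qed.

Let mtraj : measurable_fun setT traj.
Proof.
apply: (@measurability _ _ _ path_space setT traj coordinate_sets erefl) => _ [_ [k _ [x _ <-]] <-].
rewrite setTI.
have -> : traj @^-1` [set w | w k = x] =
    \bigcup_(t in [set t : k.+1.-tuple X | head point t = x])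
      [set u | inC t u] `|`
    (if x == point then ~` [set u | inC [::] u] else set0).
  apply/seteqP; split=> u /=; rewrite /traj.
    case u01: (0 <= u < 1) => ux.
      left; exists (tcast (size_hist k.+1 u) (in_tuple (hist k.+1 u))).
        by rewrite /= val_tcast.
      by rewrite val_tcast; exact: hist_inC.
    right; move: ux; rewrite hist_out //= => <-.
    by rewrite eqxx /= inC_nil u01.
  case=> [[t /= tx Ct]|].
    have u01 := inC01 Ct; have := histE t u01.
    by rewrite Ct size_tuple => /eqP /(congr1 (head point)); rewrite tx.
  case: eqP => [-> /=|//]; rewrite inC_nil => /negP/negbTE u01.
  by have /(congr1 (head point)) := hist_out k.+1 u01.
apply: measurableU.
  by apply: fin_bigcup_measurable => [|t _]; [exact: finite_finset | exact: mC].
by case: ifP => // _; apply: measurableC; exact: mC.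
Qed.

Let unif := mrestr (@lebesgue_measure R) (mC [::]).
HB.instance Definition _ := Measure.on unif.

Let lebC h : (@lebesgue_measure R) [set u | inC h u] = (wt h)%:E.
Proof.
rewrite CE lebesgue_measure_itv /= lte_fin ltrDl; case: ltP => w0.
  by rewrite -EFinB addrAC subrr add0r.
by congr EFin; apply/le_anti; rewrite w0 wt_ge0.
Qed.

Let unifT : unif setT = 1%E.
Proof. by rewrite /unif /mrestr setTI lebC. Qed.
HB.instance Definition _ := Measure_isProbability.Build _ _ _ unif unifT.

HB.instance Definition _ := isMeasurableFun.Build _ _ _ _ traj mtraj.

Lemma markov_lawP : is_markov_law q0 K (markov_law q0 K).
Proof.
apply: (getPex (P := is_markov_law q0 K)); exists (distribution unif traj : probability path_space R).
move=> n x.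
transitivity ((@lebesgue_measure R)
  (traj @^-1` [set w | forall k, (k <= n)%N -> w k = x k]
    `&` [set u | inC [::] u])); first by [].
pose rh := fix rh n := if n is n'.+1 then x n :: rh n' else [:: x 0%N].
have rhE m u : (forall k, (k <= m)%N -> traj u k = x k) <-> hist m.+1 u = rh m.
  elim: m => [|m IH].
    split=> [/(_ 0%N isT) /= <- //|E k].
    by rewrite leqn0 => /eqP ->; exact: (congr1 (head point) E).
  split=> [H|E k].
    have E : hist m.+1 u = rh m by apply/IH => k km; apply: H; rewrite leqW.
    rewrite -[RHS]/(x m.+1 :: rh m) -(H m.+1 (leqnn _)) -E.
    by [].
  have /IH H : hist m.+1 u = rh m := congr1 behead E.
  rewrite leq_eqVlt => /predU1P[->|/H //].
  exact: (congr1 (head point) E).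
have srh m : size (rh m) = m.+1 by elim: m => //= m ->.
rewrite (_ : _ `&` _ = [set u | inC (rh n) u]).
  rewrite [LHS]lebC; congr EFin.
  elim: n => [|n IH]; first by rewrite big_ord0 /= mul1r mulr1.
  rewrite big_ord_recr /= mulrA -IH; congr (_ * _).
  by case: n {IH}.
apply/seteqP; split=> u /=; rewrite inC_nil.
  by move=> [/rhE <- u01]; exact: hist_inC.
move=> Cu; have u01 := inC01 Cu; split=> //; apply/rhE/eqP.
by rewrite -{1}(srh n) histE.
Qed.

End existence.
End MarkovLaw.

Section MDP.
Context {R : realType} {S A : finPointedType}.

Record mdp (rmax : R) := MDP {
  init : S -> R;
  trans : S -> A -> S -> R;
  reward : S -> A -> S -> R;
  init_dist : is_dist init;
  trans_dist : forall s a, is_dist (trans s a);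
  reward_itv : forall s a s', 0 <= reward s a s' <= rmax }.

Context {rmax : R}.
Implicit Types (M : mdp rmax) (gamma : R) (pi : S -> A -> R).

(* Trajectories are sequences of state-action pairs [(s_t, a_t)]; [q0] is the
   law of [(s_0, a_0)]. *)
Definition traj_law M pi (q0 : S * A -> R) : probability (@path_space (S * A)%type) R :=
  markov_law q0 (fun x y => trans M x.1 x.2 y.1 * pi y.1 y.2).

(* The terms are nonnegative, so the series is taken in the extended reals. *)
Definition discounted_return M gamma (w : nat -> S * A) : \bar R :=
  \sum_(0 <= t <oo)
    (gamma ^+ t * reward M (w t).1 (w t).2 (w t.+1).1)%:E.

Definition expected_return M gamma pi (q0 : S * A -> R) : R :=
  fine (\int[traj_law M pi q0]_w discounted_return M gamma w).

Definition value M gamma pi (s : S) : R :=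
  expected_return M gamma pi (fun x => (x.1 == s)%:R * pi s x.2).

Definition qvalue M gamma pi (s : S) (a : A) : R :=
  expected_return M gamma pi (fun x => (x == (s, a))%:R).

Definition advantage M gamma pi (s : S) (a : A) : R :=
  qvalue M gamma pi s a - value M gamma pi s.

Definition total_reward M gamma pi : R :=
  \sum_s init M s * value M gamma pi s.

Definition start_law M pi (x : S * A) : R := init M x.1 * pi x.1 x.2.

Definition visitation M gamma pi (s : S) : R :=
  fine ((1 - gamma)%:E * \sum_(0 <= t <oo) (gamma ^+ t)%:E *
    traj_law M pi (start_law M pi)
      [set w : nat -> S * A | (w t).1 = s])%E.

Definition softmax (theta : S -> A -> R) : S -> A -> R :=
  fun s a => expR (theta s a) / \sum_b expR (theta s b).

(* D_KL(p || q), with the conventions 0 ln (0 / q) = 0 and p ln (p / 0) = +oo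
   for p > 0. *)
Definition kl (p q : A -> R) : \bar R :=
  (\sum_a (if p a == 0%R then 0
            else if q a == 0%R then +oo else (p a * ln (p a / q a))%:E))%E.

Inductive divergence := D1 | D2.

Definition sqdist (i : divergence) (pi pi' : S -> A -> R) (s : S) : \bar R :=
  match i with
  | D1 => kl (pi s) (pi' s)
  | D2 => kl (pi' s) (pi s)
  end.

Definition alg_objective (i : divergence) M gamma (lambda : R)
    (phi : S -> A -> R) (s : S) (p : A -> R) : \bar R :=
  ((\sum_a p a * qvalue M gamma (softmax phi) s a)%R%:E
    - lambda%:E * sqdist i (softmax phi) (fun=> p) s)%E.

(* For [0 < lambda] the maximizer exists and is unique. *)
Definition alg (i : divergence) gamma (lambda : R) (phi : S -> A -> R) M :
    S -> A -> R :=
  fun s => get [set p : A -> R | is_dist p /\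
    forall q, is_dist q -> (alg_objective i M gamma lambda phi s q <=
                            alg_objective i M gamma lambda phi s p)%E].

Definition grad (F : (S -> A -> R) -> R) (phi : S -> A -> R) : S -> A -> R :=
  fun s a =>
    derive1 (fun h : R =>
      F (fun s' a' => phi s' a' + h * ((s', a') == (s, a))%:R)) 0.

Definition sqnorm (g : S -> A -> R) : R := \sum_s \sum_a g s a ^+ 2.

Context {d : measure_display} {Gamma : measurableType d}.
Variable task : Gamma -> mdp rmax.

Definition measurable_tasks : Prop :=
  [/\ forall s, measurable_fun setT (fun tau => init (task tau) s),
      forall s a s', measurable_fun setT (fun tau => trans (task tau) s a s') &
      forall s a s', measurable_fun setT (fun tau => reward (task tau) s a s')].

Definition adapted_reward i gamma lambda (tau : Gamma) (phi : S -> A -> R) : R :=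
  total_reward (task tau) gamma (alg i gamma lambda phi (task tau)).

Definition meta_objective (mu : probability Gamma R) i gamma lambda
    (phi : S -> A -> R) : R :=
  fine 'E_mu[fun tau => adapted_reward i gamma lambda tau phi].

Fixpoint meta_iter i gamma lambda (alpha : R) (phi0 : S -> A -> R)
    (tau : nat -> Gamma) (t : nat) : S -> A -> R :=
  if t is t'.+1 then
    let phi := meta_iter i gamma lambda alpha phi0 tau t' in
    fun s a => phi s a + alpha * grad (adapted_reward i gamma lambda (tau t')) phi s a
  else phi0.

End MDP.

Definition iid {R : realType} {dO dG : measure_display}
    {Omega : measurableType dO} {Gamma : measurableType dG}
    (P : probability Omega R) (mu : probability Gamma R)
    (X : nat -> {mfun Omega >-> Gamma}) : Prop :=
  (forall t (B : set Gamma), measurable B -> distribution P (X t) B = mu B) /\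
  (forall (J : seq nat) (B : nat -> set Gamma), uniq J ->
     (forall j, measurable (B j)) ->
     P (\bigcap_(j in [set` J]) (X j @^-1` B j)) =
     (\prod_(j <- J) P (X j @^-1` B j))%E).

Section Constants.
Context {R : realType}.
Variables (i : divergence) (gamma rmax Amax lambda : R).

Definition cstB : R :=
  match i with
  | D1 => 16 * rmax / (lambda * (1 - gamma) ^+ 3) + 24 / (1 - gamma) + 12 / lambda
  | D2 => 16 * rmax / (lambda * (1 - gamma) ^+ 3) + 18 / (1 - gamma) ^+ 2
  end.

Definition cstC : R :=
  match i with D1 => 6 / (1 - gamma) | D2 => 4 / (1 - gamma) end.

Definition cstG : R :=
  match i with
  | D1 => 4 * Amax / (1 - gamma) ^+ 2
  | D2 => 2 * Amax / (1 - gamma) ^+ 2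
  end.

Definition cstK : R :=
  2 * (cstB + 2 * cstC ^+ 2) * rmax ^+ 2 / (1 - gamma) ^+ 4.

Definition cstM : R :=
  (cstB + 2 * cstC ^+ 2) * cstG * rmax / (1 - gamma) ^+ 4.

Definition step_size (T : nat) : R :=
  Num.min
    (rmax * cstB / (1 - gamma) ^+ 2
       + 2 * gamma * rmax * cstC ^+ 2 / (1 - gamma) ^+ 3)^-1
    (1 / (cstG * Num.sqrt T%:R)).

End Constants.

(* Main.v *)
(* The adapted policy has a closed form: for [D2] it is the softmax of
   [phi + Q / lambda], for [D1] it is [softmax phi / (c - Q / lambda)] with [c] the
   normalizing constant; [2 Amax <= lambda] keeps [c - Q / lambda] between 1/2 and 2.
   Both are strict maximizers by [ln z < z - 1].

   Smoothness of [phi |-> J (alg phi)] is proved without differentiating implicit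
   functions: subtracting the Bellman equations (or the normalization equations) at
   two parameters gives exact difference identities, and the linearized equations
   define the differential. Comparing the two, the increment, the differential and
   the second-order remainder are bounded in sup norm through the contraction of
   the discounted Bellman operator. Only the softmax map needs calculus (two uses
   of the mean value theorem along a segment). A quadratic remainder bound
   identifies the coordinate gradients, passes to the average over tasks and gives
   the descent inequality.

   The iterate [phi_t] is measurable for the past [tau_0, ..., tau_(t - 1)], which is
   independent of [tau_t]; hence the cross term of the descent inequality averages
   to the squared norm of the gradient of the meta-objective. Telescoping over
   [t = 1, ..., T] and inserting the step size concludes; the constants of the
   statement dominate those obtained here. *)

Require Import Defs.
From HB Require Import structures.
From mathcomp Require Import all_boot all_order all_algebra.
From mathcomp Require Import all_classical all_reals all_analysis measurable_realfun.
From mathcomp Require Import ring lra.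

Set Implicit Arguments.
Unset Strict Implicit.
Unset Printing Implicit Defensive.

Import Order.TTheory GRing.Theory Num.Theory.
Import numFieldNormedType.Exports.

Local Open Scope classical_set_scope.
Local Open Scope ring_scope.

(** * Discounted sums over finite Markov chains *)

(** Parameters and action values are measured in sup norm, policies in l1 norm over actions. No
    constant then depends on the number of states or actions, and since the sup norm is below the
    Euclidean one, the bounds pass to Euclidean gradients without loss. A difference of two policies
    has zero mass, so only advantages enter; (A1), stated for softmax policies, reaches the adapted
    policy because every strictly positive policy is a softmax policy. Two advantage bounds are in
    play: [Amax] controls [Q / lambda] inside the adaptation, while [rmax / (1 - gamma)] yields a
    smoothness constant proportional to [rmax], as the final constants demand. The remainder bound
    is global in the increment and uniform over tasks, so it also makes gradients measurable, as
    limits of difference quotients. Objects chosen by [get] are reached only through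
    characterizations: strict maximality for [alg], the order criterion [normalizer_le] for the
    measurability of the constant of [D1]. *)

Section FiniteDistributions.
Variables (R : realType) (X : finType).
Implicit Types (p u v : X -> R).

Lemma dist_le p u B : is_dist p -> (forall x, u x <= B) ->
  \sum_x p x * u x <= B.
Proof.
move=> [p0 p1] uB; rewrite -[leRHS]mul1r -p1 mulr_suml.
by apply: ler_sum => x _; exact: ler_wpM2l.
Qed.

Lemma dist_ge p u B : is_dist p -> (forall x, B <= u x) ->
  B <= \sum_x p x * u x.
Proof.
move=> [p0 p1] uB; rewrite -[leLHS]mul1r -p1 mulr_suml.
by apply: ler_sum => x _; exact: ler_wpM2l.
Qed.

Lemma dist_norm_le p u B : is_dist p -> (forall x, `|u x| <= B) ->
  `|\sum_x p x * u x| <= B.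
Proof.
move=> pd uB; rewrite ler_norml dist_le ?dist_ge // => x;
  by have := uB x; rewrite ler_norml => /andP[].
Qed.

Lemma l1_norm_le p u B c : \sum_x `|p x| <= c -> 0 <= B ->
  (forall x, `|u x| <= B) -> `|\sum_x p x * u x| <= c * B.
Proof.
move=> pc B0 uB; apply: le_trans (ler_wpM2r B0 pc).
rewrite mulr_suml; apply: le_trans (ler_norm_sum _ _ _) _.
by apply: ler_sum => x _; rewrite normrM ler_wpM2l.
Qed.

Lemma is_dist_delta (x : X) : is_dist (fun y => (y == x)%:R : R).
Proof.
split=> [y|]; first exact: ler0n.
by rewrite (bigD1 x) //= eqxx big1 ?addr0 // => y /negbTE ->.
Qed.

Lemma sum_delta (x : X) u : \sum_y (y == x)%:R * u y = u x.
Proof.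
by rewrite (bigD1 x) //= eqxx mul1r big1 ?addr0 // => y /negbTE ->; rewrite mul0r.
Qed.

End FiniteDistributions.

Section DiscountedSums.
Variables (R : realType) (X : finType) (gamma : R).
Hypothesis hgamma : 0 < gamma < 1.
Implicit Types (K : X -> X -> R) (b u : X -> R).

Definition markov_op K b : X -> R := fun x => \sum_y K x y * b y.

Definition disc_term K b (x : X) (t : nat) : R :=
  gamma ^+ t * iter t (markov_op K) b x.

(** The resolvent [(1 - gamma K)^-1] applied to [b], as a Neumann series. *)
Definition disc K b (x : X) : R := limn (series (disc_term K b x)).

Let g0 : 0 < gamma. Proof. by case/andP: hgamma. Qed.
Let g1 : gamma < 1. Proof. by case/andP: hgamma. Qed.
Let g1' : 0 < 1 - gamma. Proof. by rewrite subr_gt0. Qed.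

(** At a point where [|u|] is maximal the equation gives [max <= B + gamma * max]. The bounds on
    action values, their differentials and their remainders all reduce to this. *)
Lemma discount_contraction K b u B : (forall x, is_dist (K x)) ->
  (forall x, u x = b x + gamma * markov_op K u x) ->
  (forall x, `|b x| <= B) -> forall x, `|u x| <= B / (1 - gamma).
Proof.
move=> Kd uE bB x; rewrite ler_pdivlMr //.
case: (@Order.TotalTheory.arg_maxP _ _ X x predT (fun y => `|u y|) isT) => z _ zmax.
have h : `|u z| <= B + gamma * `|u z|.
  rewrite {1}uE; apply: le_trans (ler_normD _ _) _; rewrite lerD //.
  rewrite normrM ger0_norm ?(ltW g0) // ler_wpM2l ?(ltW g0) //.
  by apply: dist_norm_le => // y; exact: (zmax y isT).
have zx : `|u x| <= `|u z| := zmax x isT.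
by apply: le_trans (ler_wpM2r (ltW g1') zx) _; lra.
Qed.

Lemma discount_unique K b u u' : (forall x, is_dist (K x)) ->
  (forall x, u x = b x + gamma * markov_op K u x) ->
  (forall x, u' x = b x + gamma * markov_op K u' x) -> u =1 u'.
Proof.
move=> Kd uE u'E x; apply/eqP; rewrite -subr_eq0 -normr_le0.
rewrite -[leRHS](mul0r (1 - gamma)^-1).
apply: (@discount_contraction K (fun=> 0) (fun x => u x - u' x)) => // y.
  rewrite [in LHS]uE [in LHS]u'E /= add0r opprD addrACA subrr add0r -mulrBr -sumrB.
  by congr (_ * _); apply: eq_bigr => z _; rewrite mulrBr.
by rewrite normr0.
Qed.

Lemma markov_op_bound K b B : (forall x, is_dist (K x)) ->
  (forall x, `|b x| <= B) -> forall t x, `|iter t (markov_op K) b x| <= B.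
Proof.
move=> Kd bB; elim=> [//|t IH] x /=.
exact: dist_norm_le.
Qed.

Lemma is_cvg_disc K b x : (forall x, is_dist (K x)) ->
  cvgn (series (disc_term K b x)).
Proof.
move=> Kd; apply: normed_cvg.
pose B := \sum_y `|b y|.
have bB y : `|b y| <= B by rewrite /B (bigD1 y) //= lerDl sumr_ge0.
apply: (@series_le_cvg _ _ (geometric B gamma)) => [n|n|n|].
- exact: normr_ge0.
- by rewrite /= mulr_ge0 ?exprn_ge0 ?(ltW g0) // (le_trans _ (bB x)).
- rewrite /= /disc_term normrM ger0_norm ?exprn_ge0 ?(ltW g0) // mulrC.
  by rewrite ler_wpM2r ?exprn_ge0 ?(ltW g0) //; exact: markov_op_bound.
- by apply: is_cvg_geometric_series; rewrite ger0_norm // ltW.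
Qed.

Lemma discE K b x : (forall x, is_dist (K x)) ->
  disc K b x = b x + gamma * markov_op K (disc K b) x.
Proof.
move=> Kd; rewrite {1}/disc; apply: cvg_lim => //.
rewrite -(cvg_shiftS (series _)).
have -> : [sequence series (disc_term K b x) n.+1]_n =
    (fun n => b x + gamma * \sum_y K x y * series (disc_term K b y) n).
  apply/funext => n /=; rewrite /series /= big_nat_recl //= /disc_term expr0 mul1r.
  congr (_ + _); under [in RHS]eq_bigr do rewrite mulr_sumr.
  rewrite exchange_big /= mulr_sumr; apply: eq_bigr => t _.
  rewrite exprS -mulrA; congr (_ * _); rewrite /markov_op mulr_sumr.
  by apply: eq_bigr => y _; rewrite mulrCA.
apply: cvgD; first exact: cvg_cst.
apply: cvgM; first exact: cvg_cst.
apply: cvg_big => [|y _]; first exact: add_continuous.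
by apply: cvgM; [exact: cvg_cst | exact: is_cvg_disc].
Qed.

Lemma disc_bound K b B x : (forall x, is_dist (K x)) ->
  (forall x, `|b x| <= B) -> `|disc K b x| <= B / (1 - gamma).
Proof.
by move=> Kd bB; apply: discount_contraction => // {}x; exact: discE.
Qed.

Lemma disc_linear K b b' (c : R) x : (forall x, is_dist (K x)) ->
  disc K (fun y => c * b y + b' y) x = c * disc K b x + disc K b' x.
Proof.
move=> Kd; move: x; apply: (discount_unique Kd) => x; first exact: discE.
rewrite [in LHS](discE b x Kd) [in LHS](discE b' x Kd) mulrDr addrACA.
congr (_ + _); rewrite (mulrCA c) -mulrDr; congr (_ * _).
rewrite /markov_op mulr_sumr -big_split /=.
by apply: eq_bigr => y _; rewrite mulrDr mulrCA.
Qed.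

End DiscountedSums.

(** * Finite-dimensional laws of the trajectory measure *)

Section MarkovChains.
Variables (R : realType) (X : finPointedType).

Lemma measure_finite_partition d (T : measurableType d)
    (m : {measure set T -> \bar R}) (F : X -> set T) :
  (forall x, measurable (F x)) ->
  (forall x y w, F x w -> F y w -> x = y) ->
  m [set w | exists x, F x w] = (\sum_x m (F x))%E.
Proof.
move=> mF Finj.
have EB : [set w | exists x, F x w] = \bigcup_(x in [set: X]) F x.
  by apply/seteqP; split=> w [x]; [exists x | move=> _ Fx; exists x].
have mB : measurable [set w | exists x, F x w].
  by rewrite EB; apply: fin_bigcup_measurable => // ; exact: finite_finset.
rewrite -[in LHS](setIT [set w | _]) -integral_indic //.
under [RHS]eq_bigr do rewrite -[X in m X]setIT -integral_indic //.
rewrite -ge0_integral_sum //; last first.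
  by move=> x; apply/measurable_EFinP; exact: measurable_indic.
apply: eq_integral => w _; rewrite sumEFin; congr EFin.
rewrite indicE; case: (boolP (w \in _)) => [|]; rewrite ?inE.
  case=> x Fx; rewrite (bigD1 x) //= indicE mem_set // big1 ?addr0 // => y yx.
  rewrite indicE memNset // => Fy; move/eqP: yx; apply; exact: Finj Fy Fx.
rewrite notin_setE => nF; rewrite big1 // => x _.
by rewrite indicE memNset // => Fx; apply: nF; exists x.
Qed.

Variables (q0 : X -> R) (K : X -> X -> R).
Hypotheses (q0d : is_dist q0) (Kd : forall x, is_dist (K x)).

Fixpoint marginal (n : nat) : X -> R :=
  if n is n'.+1 then fun y => \sum_x marginal n' x * K x y else q0.

Let m := markov_law q0 K.

Lemma measurable_coordinate k (x : X) :
  measurable ([set w : nat -> X | w k = x] : set (@path_space X)).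
Proof. by apply: sub_sigma_algebra; exists k => //; exists x. Qed.

Lemma measurable_window j n (x : nat -> X) :
  measurable ([set w : nat -> X | forall k, (j <= k <= n)%N -> w k = x k]
    : set (@path_space X)).
Proof.
have -> : [set w : nat -> X | forall k, (j <= k <= n)%N -> w k = x k] =
    \bigcap_(k in [set k | (j <= k <= n)%N]) [set w | w k = x k].
  by apply/seteqP; split=> w H k; exact: H.
by apply: bigcap_measurableType => k _; exact: measurable_coordinate.
Qed.

(** The law is specified only on windows starting at time 0. The start moves forward one step at a
    time: the window from [j.+1] splits according to the value at time [j], and summing over that
    value produces the next marginal. *)
Lemma markov_window j n (x : nat -> X) : (j <= n)%N ->
  m [set w : nat -> X | forall k, (j <= k <= n)%N -> w k = x k] =
    (marginal j (x j) * \prod_(j <= k < n) K (x k) (x k.+1))%:E.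
Proof.
elim: j x => [|j IH] x jn.
  by rewrite big_mkord -(markov_lawP q0d Kd); congr (m _).
pose xz z k := if k == j then z else x k.
have xzE z k : (j < k)%N -> xz z k = x k by rewrite /xz; case: ltngtP.
pose F z := [set w : nat -> X | forall k, (j <= k <= n)%N -> w k = xz z k].
have -> : [set w : nat -> X | forall k, (j < k <= n)%N -> w k = x k] =
    [set w | exists z, F z w].
  apply/seteqP; split=> [w H|w [z Fz] k /andP[jk kn]].
    exists (w j) => k /andP[]; rewrite leq_eqVlt => /predU1P[<- _|jk kn].
      by rewrite /xz eqxx.
    by rewrite xzE // H // jk.
  by rewrite Fz ?xzE // kn (ltnW jk).
rewrite measure_finite_partition; last 2 first.
- by move=> z; exact: measurable_window.
- move=> y z w Fy Fz; have jj : (j <= j <= n)%N by rewrite leqnn ltnW.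
  by have := Fy j jj; rewrite (Fz j jj) /xz eqxx.
transitivity (\sum_z (marginal j z * K z (x j.+1) *
    \prod_(j.+1 <= k < n) K (x k) (x k.+1))%:E)%E; last first.
  by rewrite sumEFin -mulr_suml.
apply: eq_bigr => z _; apply: etrans (IH (xz z) (ltnW jn)) _.
rewrite big_ltn // mulrA [xz z j]/xz eqxx xzE //; congr (_ * _)%:E.
by apply: eq_big_nat => k /andP[jk _]; rewrite !xzE // ltnW.
Qed.

Lemma markov_step n (x y : X) :
  m [set w : nat -> X | w n = x /\ w n.+1 = y] = (marginal n x * K x y)%:E.
Proof.
pose xy k := if k == n then x else y.
have nE : (n.+1 == n) = false by apply/negbTE; rewrite neq_ltn ltnSn orbT.
transitivity (m [set w : nat -> X | forall k, (n <= k <= n.+1)%N -> w k = xy k]).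
  congr (m _); apply/seteqP; split=> w /=.
    case=> wx wy k /andP[]; rewrite leq_eqVlt => /predU1P[<- _|nk kn].
      by rewrite /xy eqxx.
    have -> : k = n.+1 by apply/eqP; rewrite eqn_leq kn.
    by rewrite /xy nE.
  move=> H; split; rewrite H ?leqnn ?leqnSn //.
    by rewrite /xy eqxx.
  by rewrite /xy nE.
by rewrite markov_window // big_nat1 /xy eqxx nE.
Qed.

(** Moves the transition operator from the law to the function; this is how expected rewards at time
    [n] become terms of [disc]. *)
Lemma marginal_avg n (b : X -> R) :
  \sum_x marginal n x * b x = \sum_x q0 x * iter n (markov_op K) b x.
Proof.
elim: n b => [//|n IH] b; rewrite iterSr -IH /=.
under eq_bigr do rewrite mulr_suml.
rewrite exchange_big /=; apply: eq_bigr => x _.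
by rewrite /markov_op mulr_sumr; apply: eq_bigr => y _; rewrite mulrA.
Qed.

Lemma integral_step n (r : X -> X -> R) : (forall x y, 0 <= r x y) ->
  (\int[m]_w (r (w n) (w n.+1))%:E =
   (\sum_x marginal n x * \sum_y K x y * r x y)%:E)%E.
Proof.
move=> r0.
pose E (p : X * X) := [set w : nat -> X | w n = p.1 /\ w n.+1 = p.2].
have mE p : measurable (E p : set (@path_space X)).
  by apply: measurableI; exact: measurable_coordinate.
under eq_integral => w _.
  rewrite (_ : r (w n) (w n.+1) = \sum_(p : X * X) r p.1 p.2 * \1_(E p) w).
    rewrite -sumEFin; over.
  rewrite (bigD1 (w n, w n.+1)) //= indicE mem_set // mulr1 big1 ?addr0 //.
  move=> [a c] /= pw; rewrite indicE memNset ?mulr0 // => -[/= ea ec].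
  by rewrite ea ec eqxx in pw.
rewrite ge0_integral_sum //; last 2 first.
- move=> p; apply/measurable_EFinP; exact: measurable_funM.
- by move=> p w _; rewrite lee_fin mulr_ge0.
under eq_bigr => p _.
  under eq_integral do rewrite EFinM.
  rewrite ge0_integralZl_EFin //; last by apply/measurable_EFinP; exact: measurable_indic.
  rewrite integral_indic // setIT [X in (_ * X)%E]markov_step -EFinM; over.
rewrite sumEFin; congr EFin.
rewrite -(pair_big predT predT (fun x y => r x y * (marginal n x * K x y))) /=.
apply: eq_bigr => x _; rewrite mulr_sumr; apply: eq_bigr => y _; ring.
Qed.

End MarkovChains.

(** * Bellman equations for the trajectory-law values *)

Lemma sum_pairE (V : nmodType) (I J : finType) (f : I * J -> V) :
  \sum_x f x = \sum_i \sum_j f (i, j).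
Proof. by rewrite pair_bigA; apply: eq_bigr => -[]. Qed.

Section MDPValues.
Variables (R : realType) (S A : finPointedType) (rmax gamma : R).
Hypothesis hgamma : 0 < gamma < 1.
Implicit Types (M : @mdp R S A rmax) (pi : S -> A -> R) (x y : S * A).

Definition sa_kernel M pi x y : R := trans M x.1 x.2 y.1 * pi y.1 y.2.

Definition mean_reward M x : R :=
  \sum_s trans M x.1 x.2 s * reward M x.1 x.2 s.

Lemma markov_op_sa M pi (b : S * A -> R) x :
  markov_op (sa_kernel M pi) b x =
  \sum_s trans M x.1 x.2 s * \sum_a pi s a * b (s, a).
Proof.
rewrite /markov_op sum_pairE.
apply: eq_bigr => s _; rewrite mulr_sumr; apply: eq_bigr => a _.
by rewrite /sa_kernel mulrA.
Qed.

Lemma is_dist_sa (p : S -> R) pi : is_dist p -> (forall s, is_dist (pi s)) ->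
  is_dist (fun x => p x.1 * pi x.1 x.2).
Proof.
move=> [p0 p1] pid; split=> [x|].
  by rewrite mulr_ge0 //; case: (pid x.1).
rewrite sum_pairE /= -[RHS]p1.
by apply: eq_bigr => s _; rewrite -mulr_sumr; have [_ ->] := pid s; rewrite mulr1.
Qed.

Lemma sa_kernel_dist M pi x : (forall s, is_dist (pi s)) ->
  is_dist (sa_kernel M pi x).
Proof. by move=> pid; apply: is_dist_sa => //; exact: trans_dist. Qed.

Lemma mean_reward_itv M x : 0 <= mean_reward M x <= rmax.
Proof.
have rw s := reward_itv M x.1 x.2 s.
have td := trans_dist M x.1 x.2.
by apply/andP; split; [apply: dist_ge | apply: dist_le] => // s; case/andP: (rw s).
Qed.

Lemma rmax_ge0 M : 0 <= rmax.
Proof.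
have /andP[r0 r1] := reward_itv M point point point.
exact: le_trans r0 r1.
Qed.

(** Nonnegative rewards allow integral and series to be exchanged. What remains is a finite
    combination of convergent real series, so [fine] loses nothing. *)
Lemma expected_returnE M pi (q0 : S * A -> R) :
  (forall s, is_dist (pi s)) -> is_dist q0 ->
  expected_return M gamma pi q0 =
  \sum_x q0 x * disc gamma (sa_kernel M pi) (mean_reward M) x.
Proof.
move=> pid q0d; set K := sa_kernel M pi.
have Kd x : is_dist (K x) by exact: sa_kernel_dist.
pose r x y := reward M x.1 x.2 y.1.
have r0 x y : 0 <= r x y by have /andP[] := reward_itv M x.1 x.2 y.1.
have g0 t : 0 <= gamma ^+ t by rewrite exprn_ge0 // ltW //; case/andP: hgamma.
rewrite /expected_return /traj_law -/K /discounted_return.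
have mr t : measurable_fun setT
    (fun w : @path_space (S * A)%type => r (w t) (w t.+1)).
  move=> _ B mB; rewrite setTI.
  have -> : (fun w : nat -> S * A => r (w t) (w t.+1)) @^-1` B =
      \bigcup_(p in [set p : (S * A) * (S * A) | B (r p.1 p.2)])
        ([set w | w t = p.1] `&` [set w | w t.+1 = p.2]).
    apply/seteqP; split=> w /=; first by move=> Bw; exists (w t, w t.+1).
    by case=> p Bp [/= -> ->].
  apply: fin_bigcup_measurable => [|p _]; first exact: finite_finset.
  by apply: measurableI; exact: measurable_coordinate.
rewrite integral_nneseries; last 3 first.
- by [].
- by move=> t; apply/measurable_EFinP; apply: measurable_funM => //; exact: mr.
- by move=> t w _; rewrite lee_fin mulr_ge0 // r0.
have step t : (\int[markov_law q0 K]_w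
    (gamma ^+ t * r (w t) (w t.+1))%:E =
    (\sum_x q0 x * disc_term gamma K (mean_reward M) x t)%:E)%E.
  under eq_integral do rewrite EFinM.
  rewrite ge0_integralZl_EFin //; last 2 first.
  - by move=> w _; rewrite lee_fin r0.
  - by apply/measurable_EFinP; exact: mr.
  rewrite [X in (_ * X)%E]integral_step // -EFinM; congr EFin.
  (* The reward ignores the next action, so the policy sums out and the mean reward is left. *)
  rewrite (eq_bigr (fun x => marginal q0 K t x * mean_reward M x)); last first.
    move=> x _; congr (_ * _).
    have := markov_op_sa M pi (fun y => r x y) x; rewrite /markov_op => ->.
    apply: eq_bigr => s _; congr (_ * _); rewrite /r /= -mulr_suml.
    by have [_ ->] := pid s; rewrite mul1r.
  rewrite marginal_avg mulr_sumr; apply: eq_bigr => x _.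
  by rewrite /disc_term mulrCA.
transitivity (fine (limn (EFin \o (fun n => \sum_x q0 x *
    series (disc_term gamma K (mean_reward M) x) n)))).
  congr (fine (limn _)).
  apply/funext => n /=.
  rewrite (eq_bigr _ (fun t _ => step t)).
  rewrite sumEFin; congr EFin; rewrite exchange_big /=.
  by apply: eq_bigr => x _; rewrite /series /= mulr_sumr.
have cv : (fun n => \sum_x q0 x * series (disc_term gamma K (mean_reward M) x) n)
    @ \oo --> \sum_x q0 x * disc gamma K (mean_reward M) x.
  apply: cvg_big => [|x _]; first exact: add_continuous.
  by apply: cvgM; [exact: cvg_cst | exact: is_cvg_disc].
by rewrite EFin_lim; [exact: cvg_lim | apply/cvg_ex; eexists; exact: cv].
Qed.

Lemma qvalueE M pi s a : (forall s, is_dist (pi s)) ->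
  qvalue M gamma pi s a =
  disc gamma (sa_kernel M pi) (mean_reward M) (s, a).
Proof.
move=> pid; rewrite /qvalue expected_returnE //; first exact: sum_delta.
exact: is_dist_delta.
Qed.

Lemma valueE M pi s : (forall s, is_dist (pi s)) ->
  value M gamma pi s = \sum_a pi s a * qvalue M gamma pi s a.
Proof.
move=> pid; rewrite /value expected_returnE //; last first.
  apply: (@is_dist_sa (fun s' => (s' == s)%:R) (fun=> pi s)) => //.
  exact: is_dist_delta.
rewrite sum_pairE /=.
transitivity (\sum_s' (s' == s)%:R * \sum_a pi s a * qvalue M gamma pi s' a).
  apply: eq_bigr => s' _; rewrite mulr_sumr; apply: eq_bigr => a _.
  by rewrite -mulrA qvalueE.
exact: sum_delta.
Qed.

Lemma qvalue_bellman M pi s a : (forall s, is_dist (pi s)) ->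
  qvalue M gamma pi s a = mean_reward M (s, a) +
    gamma * \sum_s' trans M s a s' * \sum_a' pi s' a' * qvalue M gamma pi s' a'.
Proof.
move=> pid; rewrite qvalueE // discE //; last first.
  by move=> x; exact: sa_kernel_dist.
rewrite markov_op_sa /=; congr (_ + _ * _); apply: eq_bigr => s' _.
by congr (_ * _); apply: eq_bigr => a' _; rewrite qvalueE.
Qed.

Let g1' : 0 < 1 - gamma.
Proof. by rewrite subr_gt0; case/andP: hgamma. Qed.

Lemma disc_itv M pi (x : S * A) : (forall s, is_dist (pi s)) ->
  0 <= disc gamma (sa_kernel M pi) (mean_reward M) x <= rmax / (1 - gamma).
Proof.
move=> pid; have Kd y : is_dist (sa_kernel M pi y) by exact: sa_kernel_dist.
have rw y := mean_reward_itv M y.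
have le : `|disc gamma (sa_kernel M pi) (mean_reward M) x| <= rmax / (1 - gamma).
  by apply: disc_bound => // y; have /andP[r0 r1] := rw y; rewrite ger0_norm.
rewrite (le_trans (ler_norm _) le) andbT.
apply: limr_ge; first exact: is_cvg_disc.
near=> n; apply: sumr_ge0 => t _; rewrite mulr_ge0 //.
  by rewrite exprn_ge0 // ltW //; case/andP: hgamma.
elim: t x {le} => [|t IH] x /=; first by case/andP: (rw x).
by apply: sumr_ge0 => y _; rewrite mulr_ge0 //; case: (Kd x).
Unshelve. all: by end_near. Qed.

Lemma qvalue_itv M pi s a : (forall s, is_dist (pi s)) ->
  0 <= qvalue M gamma pi s a <= rmax / (1 - gamma).
Proof. by move=> pid; rewrite qvalueE // disc_itv. Qed.

Lemma value_itv M pi s : (forall s, is_dist (pi s)) ->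
  0 <= value M gamma pi s <= rmax / (1 - gamma).
Proof.
move=> pid; have qi a := qvalue_itv M s a pid.
rewrite valueE //; apply/andP.
by split; [apply: dist_ge | apply: dist_le] => // a; case/andP: (qi a).
Qed.

(** Both values lie in the same interval starting at 0, hence no factor 2. *)
Lemma advantage_le M pi s a : (forall s, is_dist (pi s)) ->
  `|advantage M gamma pi s a| <= rmax / (1 - gamma).
Proof.
move=> pid; have /andP[? ?] := qvalue_itv M s a pid.
have /andP[? ?] := value_itv M s pid.
by rewrite /advantage ler_norml; apply/andP; split; lra.
Qed.

Lemma total_reward_itv M pi : (forall s, is_dist (pi s)) ->
  0 <= total_reward M gamma pi <= rmax / (1 - gamma).
Proof.
move=> pid; have vi s := value_itv M s pid.
have idist := init_dist M.
apply/andP.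
by split; [apply: dist_ge | apply: dist_le] => // s; case/andP: (vi s).
Qed.

End MDPValues.

(** * Second-order bounds for softmax *)

Section SoftmaxExpansion.
Variables (R : realType) (A : finPointedType).
Implicit Types (p u v sg : A -> R).

Definition gibbs u (a : A) : R := expR (u a) / \sum_b expR (u b).

Lemma gibbs_mass_gt0 u : 0 < \sum_b expR (u b).
Proof.
by rewrite (bigD1 point) //= ltr_wpDr ?expR_gt0 // sumr_ge0 // => b _; rewrite expR_ge0.
Qed.

Lemma gibbs_gt0 u a : 0 < gibbs u a.
Proof. by rewrite divr_gt0 ?expR_gt0 // gibbs_mass_gt0. Qed.

Lemma gibbs_dist u : is_dist (gibbs u).
Proof.
split=> [a|]; first exact/ltW/gibbs_gt0.
by rewrite -mulr_suml divff // gt_eqF // gibbs_mass_gt0.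
Qed.

(* Derivative of [gibbs] at a point where its value is [p], in direction [v]. *)
Definition tilt p v (a : A) : R := p a * (v a - \sum_b p b * v b).

Lemma sum_tilt p v : is_dist p -> \sum_a tilt p v a = 0.
Proof.
move=> [_ p1]; under eq_bigr do rewrite /tilt mulrBr.
by rewrite sumrB -[X in _ - X]mulr_suml p1 mul1r subrr.
Qed.

Lemma tilt_linear p (c : R) v v' a :
  tilt p (fun b => c * v b + v' b) a = c * tilt p v a + tilt p v' a.
Proof.
rewrite /tilt [X in _ - X](_ : _ = c * \sum_b p b * v b + \sum_b p b * v' b).
  ring.
by rewrite mulr_sumr -big_split /=; apply: eq_bigr => b _; ring.
Qed.

Lemma sqr_avg_le p u : is_dist p ->
  (\sum_a p a * u a) ^+ 2 <= \sum_a p a * u a ^+ 2.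
Proof.
move=> [p0 p1]; set m := \sum_a _.
have : 0 <= \sum_a p a * (u a - m) ^+ 2.
  by apply: sumr_ge0 => a _; rewrite mulr_ge0 // sqr_ge0.
rewrite (eq_bigr (fun a => p a * u a ^+ 2 - 2 * m * (p a * u a) + m ^+ 2 * p a));
  last by move=> a _; ring.
rewrite big_split /= sumrB -!mulr_sumr -/m p1; lra.
Qed.

(** Centering at the mean only decreases the second moment, so the bound is [k ^+ 2] and not
    [(2 * k) ^+ 2]. *)
Lemma variance_le p v (k : R) : is_dist p -> (forall a, `|v a| <= k) ->
  \sum_a p a * (v a - \sum_b p b * v b) ^+ 2 <= k ^+ 2.
Proof.
move=> pd vk; set m := \sum_b p b * v b; have [p0 p1] := pd.
rewrite (eq_bigr (fun a => p a * v a ^+ 2 - 2 * m * (p a * v a) + m ^+ 2 * p a));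
  last by move=> a _; ring.
rewrite big_split /= sumrB -!mulr_sumr -/m p1.
have : \sum_a p a * v a ^+ 2 <= k ^+ 2.
  apply: dist_le => // a; rewrite -[v a ^+ 2]real_normK ?num_real //.
  by rewrite lerXn2r ?nnegrE // (le_trans _ (vk a)).
have := sqr_ge0 m; lra.
Qed.

(** The mean absolute deviation is at most the standard deviation, by [sqr_avg_le]. *)
Lemma tilt_l1 p v (k : R) : is_dist p -> (forall a, `|v a| <= k) ->
  \sum_a `|tilt p v a| <= k.
Proof.
move=> pd vk; have [p0 p1] := pd.
have k0 : 0 <= k by apply: le_trans (vk point).
rewrite (eq_bigr (fun a => p a * `|v a - \sum_b p b * v b|)); last first.
  by move=> a _; rewrite normrM ger0_norm.
rewrite -(@ler_pXn2r _ 2) ?nnegrE ?sumr_ge0 // => [|a _]; last exact: mulr_ge0.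
apply: le_trans (sqr_avg_le _ pd) (le_trans _ (variance_le pd vk)).
by apply: ler_sum => a _; rewrite real_normK ?num_real.
Qed.

Let line u v (t : R) a := u a + t * v a.

Let line0 u v : line u v 0 = u.
Proof. by apply/funext => b; rewrite /line mul0r addr0. Qed.

Let line1 u v : line u v 1 = fun b => u b + v b.
Proof. by apply/funext => b; rewrite /line mul1r. Qed.

Lemma is_derive_fsum (I : finType) (f : I -> R -> R) (df : I -> R) (t : R) :
  (forall i, is_derive t 1 (f i) (df i)) ->
  is_derive t 1 (fun x => \sum_i f i x) (\sum_i df i).
Proof.
move=> fdf; rewrite (_ : (fun x => _) = \sum_i f i); last first.
  by apply/funext => x; rewrite fct_sumE.
by elim/big_ind2 : _ => // [|] *; [exact: is_derive_cst | exact: is_deriveD].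
Qed.

Lemma is_derive_wsum (f : A -> R -> R) (df sg : A -> R) (t : R) :
  (forall a, is_derive t 1 (f a) (df a)) ->
  is_derive t 1 (fun x => \sum_a sg a * f a x) (\sum_a sg a * df a).
Proof. by move=> fdf; apply: is_derive_fsum => a; exact: is_deriveZ. Qed.

Lemma is_derive_gibbs u v a (t : R) :
  is_derive t 1 (fun t => gibbs (line u v t) a) (tilt (gibbs (line u v t)) v a).
Proof.
have de b : is_derive t 1 (fun t => expR (line u v t b)) (v b * expR (line u v t b)).
  have dl : is_derive t 1 (fun t => line u v t b) (v b).
    apply: is_derive_eq.
    by rewrite add0r mul1r scaler0 add0r [_%:A]mulr1.
  apply: is_derive_eq; exact: mulrC.
have Z0 : \sum_b expR (line u v t b) != 0 by rewrite gt_eqF // gibbs_mass_gt0.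
have dZ := is_derive_fsum de.
have dV := is_deriveV Z0 dZ.
have d := is_deriveM (de a) dV.
apply: (is_derive_eq d).
set Z := \sum_b expR (line u v t b) in Z0 *.
have -> : tilt (gibbs (line u v t)) v a = expR (line u v t a) / Z *
    (v a - Z^-1 * \sum_b v b * expR (line u v t b)).
  rewrite /tilt /gibbs -/Z mulr_sumr; congr (_ * (_ - _)).
  by apply: eq_bigr => b _; ring.
by rewrite /GRing.scale /=; field.
Qed.

Lemma is_derive_tilt u v a (t : R) :
  let p := gibbs (line u v t) in
  is_derive t 1 (fun t => tilt (gibbs (line u v t)) v a)
    (p a * ((v a - \sum_b p b * v b) ^+ 2 -
            \sum_c p c * (v c - \sum_b p b * v b) ^+ 2)).
Proof.
move=> p; have dp b := is_derive_gibbs u v b t.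
have dm : is_derive t 1 (fun t => v a - \sum_b gibbs (line u v t) b * v b)
    (- \sum_c p c * (v c - \sum_b p b * v b) ^+ 2).
  have ds : is_derive t 1 (fun t => \sum_b gibbs (line u v t) b * v b)
      (\sum_b tilt p v b * v b).
    apply: is_derive_fsum => b; apply: is_derive_eq.
    by rewrite scaler0 add0r mulrC.
  apply: is_derive_eq; rewrite add0r mul1r; congr (- _).
  (* As tilts have zero sum, [v] may be centered in the derivative of the mean, which is therefore a
     variance. *)
  transitivity (\sum_b (tilt p v b * v b - (\sum_c p c * v c) * tilt p v b)).
    by rewrite sumrB -mulr_sumr (sum_tilt _ (gibbs_dist _)) mulr0 subr0.
  by apply: eq_bigr => b _; rewrite /tilt; ring.
apply: (is_derive_eq (is_deriveM (dp a) dm)).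
by rewrite /GRing.scale /= /tilt -/p; ring.
Qed.

Lemma mvt_norm (f df : R -> R) (t b : R) : 0 <= t ->
  (forall x : R, is_derive x 1 f (df x)) ->
  (forall x : R, 0 <= x <= t -> `|df x| <= b) -> `|f t - f 0| <= b * t.
Proof.
move=> t0 fdf dfb; have fc : {within `[0, t], continuous f}.
  apply: continuous_subspaceT => x.
  exact/differentiable_continuous/derivable1_diffP.
have [x] := MVT_segment t0 (fun x _ => fdf x) fc.
rewrite in_itv /= => xt ->; rewrite subr0 normrM (ger0_norm t0).
by rewrite ler_wpM2r // dfb.
Qed.

(** The l1 norm is attained by pairing with signs. Fixing [sg] turns a vector increment into a
    scalar one, to which the mean value theorem applies. *)
Lemma l1_dual (f : A -> R) (c : R) :
  (forall sg, (forall a, `|sg a| <= 1) -> `|\sum_a sg a * f a| <= c) ->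
  \sum_a `|f a| <= c.
Proof.
move=> H; apply: le_trans (H (fun a => Num.sg (f a)) _).
  rewrite [X in _ <= `|X|](eq_bigr (fun a => `|f a|)) ?ler_norm // => a _.
  by rewrite -normrEsg.
by move=> a; rewrite normr_sg; case: (_ != _).
Qed.

Lemma l1_sg (f sg : A -> R) : (forall a, `|sg a| <= 1) ->
  `|\sum_a sg a * f a| <= \sum_a `|f a|.
Proof.
move=> sg1; apply: le_trans (ler_norm_sum _ _ _) _.
by apply: ler_sum => a _; rewrite normrM ler_piMl.
Qed.

Lemma gibbs_lipschitz u v (k : R) : (forall a, `|v a| <= k) ->
  \sum_a `|gibbs (fun b => u b + v b) a - gibbs u a| <= k.
Proof.
move=> vk; apply: l1_dual => sg sg1.
pose f t := \sum_a sg a * gibbs (line u v t) a.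
have fdf (t : R) : is_derive t 1 f (\sum_a sg a * tilt (gibbs (line u v t)) v a).
  by apply: is_derive_wsum => a; exact: is_derive_gibbs.
have := @mvt_norm f _ 1 k ler01 fdf; rewrite mulr1.
have -> : f 1 - f 0 =
    \sum_a sg a * (gibbs (fun b => u b + v b) a - gibbs u a).
  by rewrite /f line0 line1 -sumrB; apply: eq_bigr => a _; rewrite -mulrBr.
apply=> t _; apply: le_trans (l1_sg _ sg1) _.
exact: tilt_l1 (gibbs_dist _) vk.
Qed.

(** The second derivative along the segment has l1 norm at most twice a variance. The mean value
    theorem is applied to the derivative, then to the function minus its tangent, so the Taylor
    factor 1/2 is lost. *)
Lemma gibbs_expansion u v (k : R) : (forall a, `|v a| <= k) ->
  \sum_a `|gibbs (fun b => u b + v b) a - gibbs u a - tilt (gibbs u) v a|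
    <= 2 * k ^+ 2.
Proof.
move=> vk; apply: l1_dual => sg sg1.
have k20 : 0 <= 2 * k ^+ 2 by rewrite mulr_ge0 // sqr_ge0.
pose d t := \sum_a sg a * tilt (gibbs (line u v t)) v a.
have ddf (t : R) : is_derive t 1 d (\sum_a sg a *
    (gibbs (line u v t) a * ((v a - \sum_b gibbs (line u v t) b * v b) ^+ 2 -
      \sum_c gibbs (line u v t) c *
        (v c - \sum_b gibbs (line u v t) b * v b) ^+ 2))).
  by apply: is_derive_wsum => a; exact: is_derive_tilt.
have dlip t : 0 <= t -> `|d t - d 0| <= 2 * k ^+ 2 * t.
  move=> t0; apply: (mvt_norm t0 ddf) => x _; apply: le_trans (l1_sg _ sg1) _.
  set p := gibbs _; have pd : is_dist p := gibbs_dist _.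
  have := variance_le pd vk; set V := \sum_c _ => Vk.
  have [p0 p1] := pd.
  have V0 : 0 <= V by apply: sumr_ge0 => c _; rewrite mulr_ge0 // sqr_ge0.
  apply: (@le_trans _ _ (\sum_a (p a * (v a - \sum_b p b * v b) ^+ 2 + V * p a))).
    apply: ler_sum => a _; rewrite normrM ger0_norm // (mulrC V) -mulrDr.
    rewrite ler_wpM2l //; apply: le_trans (ler_normB _ _) _.
    by rewrite (ger0_norm V0) ger0_norm ?sqr_ge0.
  by rewrite big_split /= -mulr_sumr p1 -/V; lra.
pose f t := \sum_a sg a * gibbs (line u v t) a - t * d 0.
have fdf (t : R) : is_derive t 1 f (d t - d 0).
  have D : is_derive t 1 (fun t => \sum_a sg a * gibbs (line u v t) a) (d t).
    by apply: is_derive_wsum => a; exact: is_derive_gibbs.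
  apply: is_derive_eq; by rewrite scaler0 add0r [_ *: _]mulr1.
have := @mvt_norm f _ 1 (2 * k ^+ 2) ler01 fdf; rewrite mulr1.
have -> : f 1 - f 0 = \sum_a sg a *
    (gibbs (fun b => u b + v b) a - gibbs u a - tilt (gibbs u) v a).
  rewrite /f /d mul1r mul0r subr0 addrAC line0 line1 -!sumrB.
  by apply: eq_bigr => a _; rewrite -!mulrBr.
apply=> t /andP[t0 t1]; apply: le_trans (dlip t t0) _.
by rewrite ler_piMr.
Qed.

End SoftmaxExpansion.

(** * Closed forms of the KL-regularized maximizers *)

Section RegularizedMaximizers.
Variables (R : realType) (A : finPointedType).
Implicit Types (p q r x : A -> R).

Lemma ln_lt_sub1 (z : R) : 0 < z -> z != 1 -> ln z < z - 1.
Proof.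
move=> z0 z1; rewrite ltrBrDl -[ltRHS]lnK ?posrE //.
apply: expR_gt1Dx; apply: contra_neq z1 => lz0.
by rewrite -[LHS]lnK ?posrE // lz0 expR0.
Qed.

Lemma ln_le_sub1 (z : R) : 0 < z -> ln z <= z - 1.
Proof.
move=> z0; have [->|z1] := eqVneq z 1; first by rewrite ln1 subrr.
exact/ltW/ln_lt_sub1.
Qed.

Lemma sum_lt_witness (f g : A -> R) a :
  (forall b, f b <= g b) -> f a < g a -> \sum_b f b < \sum_b g b.
Proof.
by move=> fg fga; rewrite (bigD1 a) //= [ltRHS](bigD1 a) //= ltr_leD // ler_sum.
Qed.

Lemma neq_witness p q : p <> q -> exists a, p a != q a.
Proof.
move=> pq; apply: contrapT => H; apply: pq; apply/funext => a.
by apply/eqP/negP => /negP na; apply: H; exists a.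
Qed.

Lemma kl_full_supportE p q : (forall a, 0 <= p a) -> (forall a, 0 < q a) ->
  kl p q = (\sum_a p a * ln (p a / q a))%:E.
Proof.
move=> p0 q0; rewrite /kl -sumEFin; apply: eq_bigr => a _.
by case: eqP => [->|_]; rewrite ?mul0r // gt_eqF.
Qed.

(** Gibbs' inequality: termwise [p ln (p / q) >= p - q], and the right side sums to 0. Terms with
    [p a = 0] comply strictly because [q a > 0]. *)
Lemma kl_gt0 p q : is_dist p -> is_dist q -> (forall a, 0 < q a) -> p <> q ->
  0 < \sum_a p a * ln (p a / q a).
Proof.
move=> [p0 p1] [_ q1] q0 pq.
suff : \sum_a (p a - q a) < \sum_a p a * ln (p a / q a).
  by rewrite sumrB p1 q1 subrr.
have lnE a : 0 < p a -> p a * ln (p a / q a) = - (p a * ln (q a / p a)).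
  by move=> pa; rewrite -mulrN -lnV ?posrE ?divr_gt0 // invf_div.
have mulE a : 0 < p a -> p a - q a = - (p a * (q a / p a - 1)).
  by move=> pa; rewrite mulrBr mulrCA divff ?gt_eqF // !mulr1 opprB.
have [a pqa] := neq_witness pq; apply: (@sum_lt_witness (fun a => p a - q a) _ a) => [b|].
  have := p0 b; rewrite le_eqVlt => /predU1P[<-|pb].
    by rewrite mul0r sub0r oppr_le0 ltW.
  by rewrite lnE // mulE // lerN2 ler_pM2l // ln_le_sub1 // divr_gt0.
have := p0 a; rewrite le_eqVlt => /predU1P[<-|pa].
  by rewrite mul0r sub0r oppr_lt0.
rewrite lnE // mulE // ltrN2 ltr_pM2l // ln_lt_sub1 ?divr_gt0 //.
by apply: contra_neq pqa => /divr1_eq.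
Qed.

(** [get] picks an arbitrary maximizer; strictness forces that choice to be [p]. *)
Lemma argmax_get (obj : (A -> R) -> \bar R) p : is_dist p ->
  (forall q, is_dist q -> q <> p -> (obj q < obj p)%E) ->
  get [set p | is_dist p /\ forall q, is_dist q -> (obj q <= obj p)%E] = p.
Proof.
move=> pd pmax; set B := [set _ | _].
have [gd gmax] : B (get B).
  apply: getPex; exists p; split=> // q qd.
  by have [->//|/eqP qp] := eqVneq q p; exact/ltW/pmax.
apply: contrapT => gp; have := pmax _ gd gp.
by rewrite ltNge gmax.
Qed.

(** Gibbs variational principle: the objective at [r] equals [lambda * ln Z] minus [lambda] times
    the divergence of [r] from [p], so [kl_gt0] decides. *)
Lemma exp_tilting_argmax (lambda : R) u (Q : A -> R) q : 0 < lambda ->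
  let p := gibbs (fun a => u a + Q a / lambda) in
  is_dist q -> q <> p ->
  ((\sum_a q a * Q a)%:E - lambda%:E * kl q (gibbs u) <
   (\sum_a p a * Q a)%:E - lambda%:E * kl p (gibbs u))%E.
Proof.
move=> l0 p qd qp; have pd : is_dist p := gibbs_dist _.
pose Z := (\sum_b expR (u b + Q b / lambda)) / \sum_b expR (u b).
have Z0 : 0 < Z by rewrite divr_gt0 ?gibbs_mass_gt0 // (gibbs_mass_gt0 (fun b => _)).
have p0 a : 0 < p a by exact: gibbs_gt0.
have pE a : p a / gibbs u a = expR (Q a / lambda) / Z.
  rewrite /p /gibbs /Z expRD; have := gibbs_mass_gt0 u.
  have := gibbs_mass_gt0 (fun a => u a + Q a / lambda).
  move: (expR_gt0 (u a)) => /= e0 z1 z2; field.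
  by rewrite !gt_eqF.
have objE r : is_dist r -> \sum_a r a * Q a -
    lambda * \sum_a r a * ln (r a / gibbs u a) =
    lambda * ln Z - lambda * \sum_a r a * ln (r a / p a).
  move=> [r0 r1]; rewrite -[lambda * ln Z]mulr1 -r1 !mulr_sumr -!sumrB.
  apply: eq_bigr => a _; have := r0 a; rewrite le_eqVlt => /predU1P[<-|ra].
    ring.
  have -> : ln (r a / gibbs u a) = ln (r a / p a) + Q a / lambda - ln Z.
    have -> : r a / gibbs u a = (r a / p a) * (expR (Q a / lambda) / Z).
      by rewrite -pE mulrA divfK ?gt_eqF.
    have lnE : ln (expR (Q a / lambda) / Z) = Q a / lambda - ln Z.
      by rewrite ln_div ?posrE ?expR_gt0 // expRK.
    rewrite [in LHS]lnM; last 2 first.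
    - by rewrite posrE divr_gt0.
    - by rewrite posrE divr_gt0 ?expR_gt0.
    by rewrite lnE addrA.
  by field; rewrite gt_eqF.
have g0 := gibbs_gt0 u.
have [q_ge0 _] := qd; have [p_ge0 _] := pd; rewrite !kl_full_supportE //.
rewrite -!EFinM -!EFinB lte_fin !objE // ltrD2l ltrN2 ltr_pM2l //.
rewrite [ltLHS]big1 => [|a _]; last by rewrite divff ?gt_eqF // ln1 mulr0.
exact: kl_gt0.
Qed.

(** Here [lambda * c] is the Lagrange multiplier of the mass constraint: stationarity reads
    [Q + lambda * p0 / p = lambda * c]. *)
Lemma reciprocal_tilting_argmax (lambda c : R) p0 (Q : A -> R) q :
  let p a := p0 a / (c - Q a / lambda) in
  0 < lambda -> is_dist p0 -> (forall a, 0 < p0 a) ->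
  (forall a, Q a / lambda < c) -> is_dist p -> is_dist q -> q <> p ->
  ((\sum_a q a * Q a)%:E - lambda%:E * kl p0 q <
   (\sum_a p a * Q a)%:E - lambda%:E * kl p0 p)%E.
Proof.
move=> p l0 p0d p0_gt0 Qc pd [q0 q1] qp.
have d0 a : 0 < c - Q a / lambda by rewrite subr_gt0.
have p_gt0 a : 0 < p a by rewrite divr_gt0.
have [_ p1] := pd; have p0_ge0 a : 0 <= p0 a by exact: ltW.
rewrite (kl_full_supportE p0_ge0 p_gt0) -EFinM -EFinB.
(* If [q] vanishes somewhere, the divergence is infinite because [p0] has full support, and the
   objective at [q] is minus infinity. *)
have [qpos|] := pselect (forall a, 0 < q a); last first.
  move=> /existsNP[a /negP]; rewrite -leNgt => qa.
  have {}qa : q a = 0 by apply: le_anti; rewrite qa q0.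
  have -> : kl p0 q = +oo%E.
    apply/esum_eqyP => [b _|]; first by case: ifP => // _; case: ifP.
    by exists a; rewrite mem_index_enum gt_eqF // qa eqxx.
  by rewrite gt0_muley ?lte_fin // addeNy ltNyr.
rewrite (kl_full_supportE p0_ge0 qpos) -EFinM -EFinB lte_fin.
(* The multiplier term sums to 0 and turns the gap at each action into [lambda * p0] times
   [z - 1 - ln z], where [z = q / p]. *)
have E a : p a * Q a - lambda * (p0 a * ln (p0 a / p a)) +
      lambda * c * (q a - p a) -
    (q a * Q a - lambda * (p0 a * ln (p0 a / q a))) =
    lambda * p0 a * (q a / p a - 1 - ln (q a / p a)).
  rewrite !ln_div ?posrE //; move: (ln _) (ln _) (ln _) => l1 l2 l3.
  have -> : p0 a = p a * (c - Q a / lambda) by rewrite divfK // gt_eqF.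
  by field; rewrite !gt_eqF.
have -> : \sum_a p a * Q a - lambda * (\sum_a p0 a * ln (p0 a / p a)) =
    \sum_a (p a * Q a - lambda * (p0 a * ln (p0 a / p a)) +
      lambda * c * (q a - p a)).
  rewrite big_split /= sumrB -mulr_sumr -[X in _ = _ + X]mulr_sumr.
  by rewrite sumrB q1 p1 subrr mulr0 addr0.
rewrite mulr_sumr -sumrB.
have [a qpa] := neq_witness qp.
apply: (@sum_lt_witness _ _ a) => [b|].
  rewrite -subr_ge0 E mulr_ge0 ?mulr_ge0 ?(ltW l0) //.
  by rewrite subr_ge0 ln_le_sub1 // divr_gt0.
rewrite -subr_gt0 E mulr_gt0 ?mulr_gt0 // subr_gt0 ln_lt_sub1 ?divr_gt0 //.
by apply: contra_neq qpa => /divr1_eq.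
Qed.

(* The constant [c] for which [p / (c - x)] has total mass 1; it exists and is
   unique as soon as [x] is within 1/2 of its [p]-average. *)
Definition normalizer p x : R :=
  let m := \sum_a p a * x a in
  get [set c | m + 1 <= c <= m + 3 / 2 /\ \sum_a p a / (c - x a) = 1].

Section Normalizer.
Variables (p x : A -> R).
Let m := \sum_a p a * x a.
Hypotheses (pd : is_dist p) (p_gt0 : forall a, 0 < p a).
Hypothesis xm : forall a, `|x a - m| <= 1 / 2.

Let xm1 a : x a - m <= 1 / 2 /\ - (1 / 2) <= x a - m.
Proof. by have := xm a; rewrite ler_norml => /andP[]. Qed.

Lemma normalizerP : m + 1 <= normalizer p x <= m + 3 / 2 /\
  \sum_a p a / (normalizer p x - x a) = 1.
Proof.
have [p0 p1] := pd.
apply: (@getPex _ [set c | m + 1 <= c <= m + 3 / 2 /\ \sum_a p a / (c - x a) = 1]).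
pose f c := \sum_a p a / (c - x a).
have le : m + 1 <= m + 3 / 2 by rewrite lerD2l; lra.
(* With [y = x - m], one has [1 / (1 - y) >= 1 + y], and [y] has zero average under [p]. At
   [m + 3 / 2], the other end, every denominator is at least 1. *)
have f1 : 1 <= f (m + 1).
  have sum1 : \sum_a p a * (1 + (x a - m)) = 1.
    under eq_bigr do rewrite mulrDr mulr1 mulrBr.
    by rewrite big_split /= sumrB -mulr_suml p1 mul1r subrr addr0.
  rewrite -[leLHS]sum1; apply: ler_sum => a _.
  rewrite ler_wpM2l // -[leRHS]mul1r.
  have [? ?] := xm1 a.
  rewrite ler_pdivlMr; last lra.
  have := sqr_ge0 (x a - m); lra.
have f2 : f (m + 3 / 2) <= 1.
  rewrite -[leRHS]p1; apply: ler_sum => a _; have [? ?] := xm1 a.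
  rewrite ler_pdivrMr; last lra.
  by rewrite ler_peMr //; lra.
have fc : {within `[m + 1, m + 3 / 2], continuous f}.
  apply: continuous_in_subspaceT => c; rewrite inE /= in_itv /= => /andP[c1 c2].
  apply: cvg_big => [|a _]; first exact: add_continuous.
  apply: cvgM; first exact: cvg_cst.
  have [? ?] := xm1 a; apply: cvgV; first by rewrite gt_eqF //; lra.
  by apply: cvgB; [exact: cvg_id | exact: cvg_cst].
have [|c] := IVT le fc (v := 1).
  by rewrite ge_min f2 orbT le_max f1.
by rewrite in_itv /= => cm fc1; exists c.
Qed.

Lemma normalizer_gap a : 1 / 2 <= normalizer p x - x a <= 2.
Proof.
have [/andP[c1 c2] _] := normalizerP; have [? ?] := xm1 a.
by apply/andP; split; lra.
Qed.

Lemma reciprocal_tilting_dist :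
  is_dist (fun a => p a / (normalizer p x - x a)).
Proof.
have [_ c1] := normalizerP; split=> // a.
have /andP[gap _] := normalizer_gap a.
by rewrite divr_ge0 ?(ltW (p_gt0 a)) //; lra.
Qed.

(** On [c >= m + 1] all denominators are positive and the total mass is strictly decreasing in [c].
    The sublevel sets of a chosen value thus become explicit, which its measurability requires. *)
Lemma normalizer_le c : (normalizer p x <= c) =
  (m + 1 <= c) && (\sum_a p a / (c - x a) <= 1).
Proof.
have [/andP[n1 n2] nE] := normalizerP.
apply/idP/andP => [nc|[c1]].
  split; first exact: le_trans nc.
  rewrite -[leRHS]nE; apply: ler_sum => a _; have /andP[gap _] := normalizer_gap a.
  rewrite ler_wpM2l ?(ltW (p_gt0 a)) // lef_pV2 ?posrE; lra.
apply: contraTT; rewrite -!ltNge => cn; rewrite -[ltLHS]nE.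
apply: (@sum_lt_witness _ _ point) => [a|];
  [have [? ?] := xm1 a | have [? ?] := xm1 point].
  rewrite ler_wpM2l ?(ltW (p_gt0 a)) // lef_pV2 ?posrE; lra.
by rewrite ltr_pM2l // ltf_pV2 ?posrE; lra.
Qed.

End Normalizer.
End RegularizedMaximizers.

(** * Perturbation of values, rewards and adapted policies *)

Section PolicyPerturbation.
Variables (R : realType) (S A : finPointedType) (rmax gamma : R).
Hypothesis hgamma : 0 < gamma < 1.
Variables (M : @mdp R S A rmax) (p : S -> A -> R) (Abar : R).
Hypothesis pd : forall s, is_dist (p s).
Hypothesis Ap : forall s a, `|advantage M gamma p s a| <= Abar.
Implicit Types (eta q : S -> A -> R).

Let g0 : 0 < gamma. Proof. by case/andP: hgamma. Qed.
Let g1' : 0 < 1 - gamma. Proof. by rewrite subr_gt0; case/andP: hgamma. Qed.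
Let Abar0 : 0 <= Abar. Proof. exact: le_trans (Ap point point). Qed.

(* First-order variations, at the policy [p] and in the direction [eta], of the
   action values and of the total reward. *)
Definition dq eta : S * A -> R :=
  disc gamma (sa_kernel M p) (fun x => gamma * \sum_s trans M x.1 x.2 s *
    \sum_a eta s a * qvalue M gamma p s a).

Definition dreward eta : R :=
  \sum_s init M s * \sum_a (p s a * dq eta (s, a) +
                            eta s a * qvalue M gamma p s a).

(* A perturbation of zero mass does not see [value], so that [qvalue] can be
   replaced by [advantage]. *)
Lemma zero_sum_qvalue eta s (c : R) : \sum_a eta s a = 0 ->
  \sum_a `|eta s a| <= c -> `|\sum_a eta s a * qvalue M gamma p s a| <= c * Abar.
Proof.
move=> eta0 etac.
rewrite (_ : \sum_a _ = \sum_a eta s a * advantage M gamma p s a).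
  exact: l1_norm_le.
under [RHS]eq_bigr do rewrite mulrBr.
by rewrite sumrB -mulr_suml eta0 mul0r subr0.
Qed.

Lemma discounted_avg_le (f : S -> R) (B : R) (x : S * A) :
  (forall s, `|f s| <= B) ->
  `|gamma * \sum_s trans M x.1 x.2 s * f s| <= gamma * B.
Proof.
move=> fB; rewrite normrM (ger0_norm (ltW g0)) ler_wpM2l ?(ltW g0) //.
by apply: dist_norm_le => //; exact: trans_dist.
Qed.

Lemma dq_le eta (c : R) x : (forall s, \sum_a eta s a = 0) ->
  (forall s, \sum_a `|eta s a| <= c) -> `|dq eta x| <= gamma * (c * Abar) / (1 - gamma).
Proof.
move=> eta0 etac; apply: disc_bound => // [y|y]; first exact: sa_kernel_dist.
by apply: discounted_avg_le => s; exact: zero_sum_qvalue.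
Qed.

Lemma dreward_le eta (c : R) : (forall s, \sum_a eta s a = 0) ->
  (forall s, \sum_a `|eta s a| <= c) -> `|dreward eta| <= c * Abar / (1 - gamma).
Proof.
move=> eta0 etac; have id := init_dist M.
apply: (dist_norm_le id) => s; rewrite big_split /=.
have -> : c * Abar / (1 - gamma) = gamma * (c * Abar) / (1 - gamma) + c * Abar.
  by field; rewrite gt_eqF.
apply: le_trans (ler_normD _ _) _; rewrite lerD //; last exact: zero_sum_qvalue.
by apply: dist_norm_le => // a; exact: dq_le.
Qed.

Lemma dq_linear (c : R) eta eta' x :
  dq (fun s a => c * eta s a + eta' s a) x = c * dq eta x + dq eta' x.
Proof.
rewrite /dq -disc_linear //; last by move=> y; exact: sa_kernel_dist.
congr disc; apply/funext => y; rewrite (mulrCA c) -mulrDr; congr (_ * _).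
rewrite [in RHS]mulr_sumr -big_split /=; apply: eq_bigr => s _.
rewrite (mulrCA c) -mulrDr; congr (_ * _).
by rewrite [in RHS]mulr_sumr -big_split /=; apply: eq_bigr => a _; ring.
Qed.

Lemma dreward_linear (c : R) eta eta' :
  dreward (fun s a => c * eta s a + eta' s a) = c * dreward eta + dreward eta'.
Proof.
rewrite /dreward [in RHS]mulr_sumr -big_split /=; apply: eq_bigr => s _.
rewrite (mulrCA c) -mulrDr; congr (_ * _).
rewrite [in RHS]mulr_sumr -big_split /=; apply: eq_bigr => a _.
by rewrite dq_linear; ring.
Qed.

Variables (q eta : S -> A -> R) (c r : R).
Hypothesis qd : forall s, is_dist (q s).
Hypothesis eta0 : forall s, \sum_a eta s a = 0.
Hypothesis qp : forall s, \sum_a `|q s a - p s a| <= c.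
Hypothesis qpeta : forall s, \sum_a `|q s a - p s a - eta s a| <= r.

Let diff0 s : \sum_a (q s a - p s a) = 0.
Proof. by have [_ p1] := pd s; have [_ q1] := qd s; rewrite sumrB p1 q1 subrr. Qed.

Let rem0 s : \sum_a (q s a - p s a - eta s a) = 0.
Proof. by rewrite sumrB diff0 eta0 subrr. Qed.

Let Q q s a := qvalue M gamma q s a.

(** Subtracting the Bellman equations while keeping the kernel of [q] leaves the source
    [(q - p) * Q p], of zero mass, so the advantage bound at [p] suffices. *)
Lemma qvalue_lipschitz s a :
  `|Q q s a - Q p s a| <= gamma * (c * Abar) / (1 - gamma).
Proof.
apply: (@discount_contraction _ _ _ hgamma (sa_kernel M q)
  (fun x => gamma * \sum_s trans M x.1 x.2 s *
     \sum_a (q s a - p s a) * Q p s a)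
  (fun x => Q q x.1 x.2 - Q p x.1 x.2) _ _ _ _ (s, a)) => [x|x|x].
- exact: sa_kernel_dist.
- rewrite [in LHS]/Q !(qvalue_bellman hgamma) // opprD addrACA subrr add0r -mulrBr markov_op_sa.
  rewrite -mulrDr -big_split /= -sumrB; congr (_ * _); apply: eq_bigr => s' _.
  rewrite -mulrBr -mulrDr; congr (_ * _); rewrite -big_split /= -sumrB.
  by apply: eq_bigr => a' _; rewrite -!/(Q _ _ _); ring.
- by apply: discounted_avg_le => s'; exact: (@zero_sum_qvalue (fun s a => _)).
Qed.

(** With the kernel of [p] instead, and the equation of [dq] subtracted too, the source consists of
    the policy remainder against [Q p] and a product of two first-order differences. *)
Lemma qvalue_expansion s a :
  `|Q q s a - Q p s a - dq eta (s, a)| <=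
  gamma * (r * Abar + c * (gamma * (c * Abar) / (1 - gamma))) / (1 - gamma).
Proof.
apply: (@discount_contraction _ _ _ hgamma (sa_kernel M p)
  (fun x => gamma * \sum_s trans M x.1 x.2 s *
     (\sum_a (q s a - p s a - eta s a) * Q p s a +
      \sum_a (q s a - p s a) * (Q q s a - Q p s a)))
  (fun x => Q q x.1 x.2 - Q p x.1 x.2 - dq eta x) _ _ _ _ (s, a)) => [x|x|x].
- exact: sa_kernel_dist.
- rewrite [in LHS]/Q !(qvalue_bellman hgamma) // opprD addrACA subrr add0r -mulrBr.
  rewrite [in LHS]/dq discE //; last by move=> y; exact: sa_kernel_dist.
  rewrite -/(dq eta) !markov_op_sa -!mulrDr -mulrBr; congr (_ * _).
  rewrite -!big_split /= -!sumrB; apply: eq_bigr => s' _.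
  rewrite -!mulrDr -!mulrBr; congr (_ * _); rewrite -!big_split /= -!sumrB.
  by apply: eq_bigr => a' _; rewrite -!/(Q _ _ _); ring.
- apply: discounted_avg_le => s'; apply: le_trans (ler_normD _ _) _.
  apply: lerD; first exact: (@zero_sum_qvalue (fun s a => _)).
  apply: l1_norm_le => // [|a']; last exact: qvalue_lipschitz.
  exact: le_trans (qvalue_lipschitz point point).
Qed.

Lemma total_reward_expansion :
  `|total_reward M gamma q - total_reward M gamma p - dreward eta| <=
  (r * Abar + c * (gamma * (c * Abar) / (1 - gamma))) / (1 - gamma).
Proof.
set B := r * Abar + _.
(* The first summand will come from the action values, the extra [B] from the choice of the initial
   action. *)
have -> : B / (1 - gamma) = gamma * B / (1 - gamma) + B by field; rewrite gt_eqF.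
rewrite /total_reward /dreward -!sumrB.
rewrite (eq_bigr (fun s => init M s *
    (\sum_a p s a * (Q q s a - Q p s a - dq eta (s, a)) +
     (\sum_a (q s a - p s a - eta s a) * Q p s a +
      \sum_a (q s a - p s a) * (Q q s a - Q p s a))))); last first.
  move=> s _; rewrite !(valueE hgamma) // -!mulrBr; congr (_ * _).
  rewrite -!sumrB -!big_split /=.
  by apply: eq_bigr => a _; rewrite -!/(Q _ _ _); ring.
have id := init_dist M; apply: (dist_norm_le id) => s.
apply: le_trans (ler_normD _ _) _; apply: lerD.
  by apply: dist_norm_le => // a; exact: qvalue_expansion.
apply: le_trans (ler_normD _ _) _.
apply: lerD; first exact: (@zero_sum_qvalue (fun s a => _)).
apply: l1_norm_le => // [|a]; last exact: qvalue_lipschitz.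
exact: le_trans (qvalue_lipschitz point point).
Qed.

End PolicyPerturbation.

(** * Exact difference identities for the reciprocal tilting *)

Section ReciprocalTilting.
Variables (R : realType) (A : finPointedType).

(* [k] is determined by the zero-mass constraint, hence the factor 2. *)
Lemma centered_l1_le (E W F : A -> R) (k : R) : (forall a, 0 <= W a) ->
  (forall a, F a = E a - W a * k) -> \sum_a F a = 0 ->
  \sum_a `|F a| <= 2 * \sum_a `|E a|.
Proof.
move=> W0 FE; under eq_bigr do rewrite FE.
rewrite sumrB -mulr_suml => /eqP; rewrite subr_eq0 => /eqP Ek.
apply: (@le_trans _ _ (\sum_a (`|E a| + W a * `|k|))).
  apply: ler_sum => a _; rewrite FE; apply: le_trans (ler_normB _ _) _.
  by rewrite normrM (ger0_norm (W0 a)).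
rewrite big_split /= -mulr_suml mulr_natl mulr2n lerD2l.
have W0' : 0 <= \sum_a W a by apply: sumr_ge0.
rewrite -{1}(ger0_norm W0') -normrM -Ek; exact: ler_norm_sum.
Qed.

Variables (p0 p1 dp x0 x1 dx : A -> R) (c0 c1 e f r h : R).
Let d0 a := c0 - x0 a.
Let d1 a := c1 - x1 a.
Let q0 a := p0 a / d0 a.
Let q1 a := p1 a / d1 a.
Hypotheses (d0_itv : forall a, 1 / 2 <= d0 a <= 2).
Hypotheses (d1_itv : forall a, 1 / 2 <= d1 a <= 2).
Hypotheses (q0_dist : is_dist q0) (q1_dist : is_dist q1).
Hypotheses (dp_le : \sum_a `|dp a| <= e) (dx_le : forall a, `|dx a| <= f).
Hypotheses (p_le : \sum_a `|p1 a - p0 a| <= e).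
Hypotheses (x_le : forall a, `|x1 a - x0 a| <= f).
Hypotheses (rp_le : \sum_a `|p1 a - p0 a - dp a| <= r).
Hypotheses (rx_le : forall a, `|x1 a - x0 a - dx a| <= h).

(* The derivative of [p0 / (c0 - x0)] in the direction [(dp, dx)], where [c0]
   varies so as to preserve the total mass. *)
Definition reciprocal_tilt (a : A) : R :=
  let W b := q0 b / d0 b in
  let E b := dp b / d0 b + W b * dx b in
  E a - W a * ((\sum_b E b) / \sum_b W b).

Let W0 a := q0 a / d0 a.
Let W1 a := q1 a / d0 a.

Let d0_gt0 a : 0 < d0 a.
Proof. by have /andP[] := d0_itv a; lra. Qed.

Let d1_gt0 a : 0 < d1 a.
Proof. by have /andP[] := d1_itv a; lra. Qed.

Let d0V a : 1 / 2 <= (d0 a)^-1 <= 2.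
Proof.
have /andP[l u] := d0_itv a; apply/andP; split.
  by rewrite div1r lef_pV2 ?posrE.
by rewrite -[leRHS]invrK lef_pV2 ?posrE //; lra.
Qed.

Let e0 : 0 <= e. Proof. by apply: le_trans dp_le; exact: sumr_ge0. Qed.
Let f0 : 0 <= f. Proof. exact: le_trans (dx_le point). Qed.
Let h0 : 0 <= h. Proof. exact: le_trans (rx_le point). Qed.

Let div_l1 (u : A -> R) (b : R) : \sum_a `|u a| <= b -> \sum_a `|u a / d0 a| <= 2 * b.
Proof.
move=> ub; apply: (@le_trans _ _ (\sum_a 2 * `|u a|)); last first.
  by rewrite -mulr_sumr ler_pM2l.
apply: ler_sum => a _; have /andP[_ d2] := d0V a.
by rewrite normrM [`|_^-1|]gtr0_norm ?invr_gt0 // mulrC ler_wpM2r.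
Qed.

Let dist_norm (q : A -> R) : is_dist q -> \sum_a `|q a| <= 1.
Proof.
move=> [qa0 q1']; rewrite -q1'; apply: ler_sum => a _.
by rewrite ger0_norm.
Qed.

Let weighted_l1 (q u : A -> R) (b : R) : is_dist q -> (forall a, `|u a| <= b) ->
  \sum_a `|q a / d0 a * u a| <= 2 * b.
Proof.
move=> qd ub; have b0 : 0 <= b := le_trans (normr_ge0 _) (ub point).
apply: (@le_trans _ _ (\sum_a `|q a / d0 a| * b)).
  by apply: ler_sum => a _; rewrite normrM ler_wpM2l.
rewrite -mulr_suml ler_wpM2r //.
by apply: le_trans (div_l1 (dist_norm qd)) _; rewrite mulr1.
Qed.

Let weight_ge (q : A -> R) : is_dist q -> 1 / 2 <= \sum_a q a / d0 a.
Proof. by move=> qd; apply: dist_ge => // a; have /andP[] := d0V a. Qed.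

Let weight_ge0 (q : A -> R) a : is_dist q -> 0 <= q a / d0 a.
Proof. by move=> [qa _]; rewrite divr_ge0 // ltW. Qed.

Lemma sum_reciprocal_tilt : \sum_a reciprocal_tilt a = 0.
Proof.
rewrite /reciprocal_tilt sumrB -mulr_suml mulrCA divff ?mulr1 ?subrr //.
by rewrite gt_eqF //; have := weight_ge q0_dist; lra.
Qed.

Lemma reciprocal_tilt_l1 : \sum_a `|reciprocal_tilt a| <= 4 * (e + f).
Proof.
apply: le_trans (centered_l1_le (fun a => weight_ge0 a q0_dist)
  (fun=> erefl) sum_reciprocal_tilt) _.
suff : \sum_a `|dp a / d0 a + W0 a * dx a| <= 2 * e + 2 * f.
  by move=> H; apply: le_trans (ler_wpM2l _ H) _ => //; lra.
apply: (@le_trans _ _ (\sum_a (`|dp a / d0 a| + `|W0 a * dx a|))).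
  by apply: ler_sum => a _; exact: ler_normD.
by rewrite big_split lerD // ?div_l1 // weighted_l1.
Qed.

Let E1 a := (p1 a - p0 a) / d0 a + W1 a * (x1 a - x0 a).

(** Exact, not Taylor: [1 / d1 - 1 / d0 = (d0 - d1) / (d0 * d1)] yields the mixed weight [q1 / d0],
    and the unknown shift of [c] enters linearly. *)
Let qdiffE a : q1 a - q0 a = E1 a - W1 a * (c1 - c0).
Proof.
rewrite /E1 /W1 /q1 /q0 (_ : x1 a - x0 a = d0 a - d1 a + (c1 - c0)); last first.
  by rewrite /d0 /d1; ring.
by field; rewrite !gt_eqF.
Qed.

Let qdiff0 : \sum_a (q1 a - q0 a) = 0.
Proof. by rewrite sumrB; have [_ ->] := q1_dist; have [_ ->] := q0_dist; rewrite subrr. Qed.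

Lemma reciprocal_tilting_lipschitz : \sum_a `|q1 a - q0 a| <= 4 * (e + f).
Proof.
apply: le_trans (centered_l1_le (fun a => weight_ge0 a q1_dist)
  qdiffE qdiff0) _.
suff : \sum_a `|E1 a| <= 2 * e + 2 * f.
  by move=> H; apply: le_trans (ler_wpM2l _ H) _ => //; lra.
apply: (@le_trans _ _ (\sum_a (`|(p1 a - p0 a) / d0 a| + `|W1 a * (x1 a - x0 a)|))).
  by apply: ler_sum => a _; exact: ler_normD.
by rewrite big_split lerD // ?div_l1 // weighted_l1.
Qed.

(** Summing [qdiffE] removes its left side and leaves an equation for [c1 - c0]. Its coefficient is
    at least 1/2, whence [4 * e], and is also a factor of the [f] term. *)
Let cdiff_le : `|c1 - c0| <= 4 * e + f.
Proof.
have Wge := weight_ge q1_dist; have W_gt0 : 0 < \sum_a W1 a by rewrite /W1; lra.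
have : (\sum_a W1 a) * `|c1 - c0| <= 2 * e + (\sum_a W1 a) * f.
  rewrite -{1}(gtr0_norm W_gt0) -normrM.
  have -> : (\sum_a W1 a) * (c1 - c0) =
      \sum_a (p1 a - p0 a) / d0 a + \sum_a W1 a * (x1 a - x0 a).
    have := qdiff0; rewrite (eq_bigr _ (fun a _ => qdiffE a)) sumrB -mulr_suml.
    by move/eqP; rewrite subr_eq0 => /eqP <-; rewrite big_split.
  apply: le_trans (ler_normD _ _) _; apply: lerD.
    by apply: le_trans (ler_norm_sum _ _ _) _; exact: div_l1.
  apply: le_trans (ler_norm_sum _ _ _) _; rewrite mulr_suml; apply: ler_sum => a _.
  by rewrite normrM ger0_norm ?weight_ge0 // ler_wpM2l // weight_ge0.
move=> H; rewrite -(ler_pM2l W_gt0); apply: le_trans H _.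
have e4 : 0 <= 4 * e by rewrite mulr_ge0.
by rewrite mulrDr lerD2r; apply: le_trans (ler_wpM2r e4 Wge); lra.
Qed.

(** The remainder again has the form [E - W0 * k], so [centered_l1_le] discards the unknown [k].
    Replacing the weight [W1] by [W0] costs the product of [q1 - q0] and [u], which is second
    order. *)
Lemma reciprocal_tilting_expansion :
  \sum_a `|q1 a - q0 a - reciprocal_tilt a| <=
  4 * r + 16 * (e + f) * (4 * e + 2 * f) + 4 * h.
Proof.
pose u a := x1 a - x0 a - (c1 - c0).
have u_le a : `|u a| <= 4 * e + 2 * f.
  by apply: le_trans (ler_normB _ _) _; have := x_le a; have := cdiff_le; lra.
pose E a := (p1 a - p0 a - dp a) / d0 a + (q1 a - q0 a) / d0 a * u a +
  W0 a * (x1 a - x0 a - dx a).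
pose dc := (\sum_a (dp a / d0 a + W0 a * dx a)) / \sum_a W0 a.
have FE a : q1 a - q0 a - reciprocal_tilt a = E a - W0 a * (c1 - c0 - dc).
  rewrite {1}qdiffE /reciprocal_tilt -/(W0 a) -/dc /E /u /E1 /W1 /W0; ring.
have F0 : \sum_a (q1 a - q0 a - reciprocal_tilt a) = 0.
  by rewrite sumrB qdiff0 sum_reciprocal_tilt subrr.
apply: le_trans (centered_l1_le (fun a => weight_ge0 a q0_dist) FE F0) _.
suff : \sum_a `|E a| <= 2 * r + 2 * (4 * (e + f)) * (4 * e + 2 * f) + 2 * h.
  by move=> H; apply: le_trans (ler_wpM2l _ H) _ => //; lra.
apply: (@le_trans _ _ (\sum_a (`|(p1 a - p0 a - dp a) / d0 a| +
    `|(q1 a - q0 a) / d0 a * u a| + `|W0 a * (x1 a - x0 a - dx a)|))).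
  apply: ler_sum => a _; apply: le_trans (ler_normD _ _) _.
  by rewrite lerD2r ler_normD.
rewrite !big_split /= !lerD ?div_l1 ?weighted_l1 //.
apply: (@le_trans _ _ (\sum_a `|(q1 a - q0 a) / d0 a| * (4 * e + 2 * f))).
  by apply: ler_sum => a _; rewrite normrM ler_wpM2l.
rewrite -mulr_suml ler_wpM2r ?div_l1 //; last exact: reciprocal_tilting_lipschitz.
by have := e0; have := f0; lra.
Qed.

End ReciprocalTilting.

Lemma reciprocal_tilt_linear (R : realType) (A : finPointedType)
    (p0 dp dp' x0 dx dx' : A -> R) (c0 k : R) a :
  reciprocal_tilt p0 (fun b => k * dp b + dp' b) x0
    (fun b => k * dx b + dx' b) c0 a =
  k * reciprocal_tilt p0 dp x0 dx c0 a + reciprocal_tilt p0 dp' x0 dx' c0 a.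
Proof.
rewrite /reciprocal_tilt.
pose W b := p0 b / (c0 - x0 b) / (c0 - x0 b).
rewrite [X in _ - _ * (X / _)](_ : _ =
   k * (\sum_b (dp b / (c0 - x0 b) + W b * dx b)) +
   \sum_b (dp' b / (c0 - x0 b) + W b * dx' b)).
  by rewrite -!/(W _); ring.
by rewrite mulr_sumr -big_split; apply: eq_bigr => b _ /=; rewrite /W; ring.
Qed.

(** * The adapted policy and its differential *)

Section WithinTaskAdaptation.
Variables (R : realType) (S A : finPointedType) (rmax gamma lambda Amax : R).
Hypotheses (hgamma : 0 < gamma < 1) (hlambda : 0 < lambda).
Variable M : @mdp R S A rmax.
Hypothesis A1 : forall theta s a, `|advantage M gamma (softmax theta) s a| <= Amax.
Hypothesis hlambdaA : 2 * Amax <= lambda.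
Implicit Types (phi v : S -> A -> R) (i : divergence).

Let g0 : 0 < gamma. Proof. by case/andP: hgamma. Qed.
Let g1' : 0 < 1 - gamma. Proof. by rewrite subr_gt0; case/andP: hgamma. Qed.
Let Amax0 : 0 <= Amax.
Proof. exact: le_trans (A1 (fun _ _ => 0) point point). Qed.

Lemma softmax_dist phi s : is_dist (softmax phi s).
Proof. exact: (gibbs_dist (phi s)). Qed.

Lemma softmax_gt0 phi s a : 0 < softmax phi s a.
Proof. exact: (gibbs_gt0 (phi s)). Qed.

(** Makes (A1), stated for softmax policies, available for every policy of full support, in
    particular the adapted one. *)
Lemma softmax_surj (p : S -> A -> R) : (forall s, is_dist (p s)) ->
  (forall s a, 0 < p s a) -> softmax (fun s a => ln (p s a)) = p.
Proof.
move=> pd p0; apply/funext => s; apply/funext => a; rewrite /softmax.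
rewrite (eq_bigr (p s)) => [|b _]; last by rewrite lnK ?posrE.
by have [_ ->] := pd s; rewrite divr1 lnK ?posrE.
Qed.

Definition scaled_q phi s a : R := qvalue M gamma (softmax phi) s a / lambda.

(** The average of [Q] is the value, so the deviation is an advantage over [lambda];
    [2 * Amax <= lambda] gives the radius 1/2 that [normalizer] asks for. *)
Lemma scaled_q_centered phi s a :
  `|scaled_q phi s a - \sum_b softmax phi s b * scaled_q phi s b| <= 1 / 2.
Proof.
have -> : \sum_b softmax phi s b * scaled_q phi s b =
    value M gamma (softmax phi) s / lambda.
  rewrite (valueE hgamma) ?mulr_suml; last by move=> s'; exact: softmax_dist.
  by apply: eq_bigr => b _; rewrite mulrA.
rewrite -mulrBl normrM [`|lambda^-1|]gtr0_norm ?invr_gt0 //.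
by rewrite ler_pdivrMr //; apply: le_trans (A1 phi s a) _; move: hlambdaA; lra.
Qed.

Definition alg_formula i phi s : A -> R :=
  match i with
  | D1 => fun a => softmax phi s a /
      (normalizer (softmax phi s) (scaled_q phi s) - scaled_q phi s a)
  | D2 => gibbs (fun a => phi s a + scaled_q phi s a)
  end.

Lemma alg_formula_dist i phi s : is_dist (alg_formula i phi s).
Proof.
case: i => /=; last exact: gibbs_dist.
apply: reciprocal_tilting_dist; first exact: softmax_dist.
  by move=> a; exact: softmax_gt0.
exact: scaled_q_centered.
Qed.

Let gap phi s a :
  1 / 2 <= normalizer (softmax phi s) (scaled_q phi s) - scaled_q phi s a <= 2.
Proof. by apply: normalizer_gap; [exact: softmax_dist | exact: scaled_q_centered]. Qed.

Lemma alg_formula_gt0 i phi s a : 0 < alg_formula i phi s a.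
Proof.
case: i => /=; last exact: gibbs_gt0.
rewrite divr_gt0 ?softmax_gt0 //; have /andP[] := gap phi s a; lra.
Qed.

Lemma algE i phi : alg i gamma lambda phi M = alg_formula i phi.
Proof.
apply/funext => s; apply: argmax_get; first exact: alg_formula_dist.
have pd := alg_formula_dist i phi s.
case: i pd => pd q qd qp; rewrite /alg_objective /sqdist.
  apply: reciprocal_tilting_argmax => //; first exact: softmax_dist.
    by move=> a; exact: softmax_gt0.
  by move=> a; rewrite -subr_gt0; have /andP[] := gap phi s a; rewrite /scaled_q; lra.
exact: (exp_tilting_argmax hlambda).
Qed.

Lemma alg_advantage_le i phi s a :
  `|advantage M gamma (alg_formula i phi) s a| <= Amax.
Proof.
rewrite -(softmax_surj (alg_formula_dist i phi)); first exact: A1.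
exact: alg_formula_gt0.
Qed.

Definition dsoftmax phi v s : A -> R := tilt (softmax phi s) (v s).

Definition dscaled_q phi v s a : R :=
  dq gamma M (softmax phi) (dsoftmax phi v) (s, a) / lambda.

Definition dalg i phi v s : A -> R :=
  match i with
  | D1 => reciprocal_tilt (softmax phi s) (dsoftmax phi v s) (scaled_q phi s)
      (dscaled_q phi v s) (normalizer (softmax phi s) (scaled_q phi s))
  | D2 => tilt (alg_formula D2 phi s) (fun a => v s a + dscaled_q phi v s a)
  end.

Lemma dalg_linear i phi (c : R) v v' s a :
  dalg i phi (fun s a => c * v s a + v' s a) s a =
  c * dalg i phi v s a + dalg i phi v' s a.
Proof.
have softE : dsoftmax phi (fun s a => c * v s a + v' s a) =
    fun s a => c * dsoftmax phi v s a + dsoftmax phi v' s a.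
  by apply/funext => s'; apply/funext => b; exact: tilt_linear.
have qE : dscaled_q phi (fun s a => c * v s a + v' s a) =
    fun s a => c * dscaled_q phi v s a + dscaled_q phi v' s a.
  apply/funext => s'; apply/funext => b.
  rewrite /dscaled_q softE dq_linear //; last by move=> s''; exact: softmax_dist.
  by rewrite mulrDl mulrA.
case: i => /=; rewrite qE; first by rewrite softE reciprocal_tilt_linear.
rewrite -tilt_linear; congr tilt; apply/funext => b; ring.
Qed.

(* [rate i * k / (1 - gamma)] and [curvature i * k ^+ 2 / (1 - gamma) ^+ 2] bound
   in l1 norm the variation of the adapted policy, resp. its second-order
   remainder, when the parameters move by at most [k] in sup norm. *)
Definition rate i : R := match i with D1 => 4 | D2 => 1 end.
Definition curvature i : R := match i with D1 => 76 | D2 => 3 end.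

Section Increment.
Variables (phi v : S -> A -> R) (k : R).
Hypothesis vk : forall s a, `|v s a| <= k.
Let phi1 s a := phi s a + v s a.
Let g := 1 - gamma.

Let k0 : 0 <= k. Proof. exact: le_trans (vk point point). Qed.

Let dsoft_le s : \sum_a `|dsoftmax phi v s a| <= k.
Proof. exact: tilt_l1 (softmax_dist _ _) (vk s). Qed.

Let dsoft0 s : \sum_a dsoftmax phi v s a = 0.
Proof. by apply: sum_tilt; exact: softmax_dist. Qed.

Let soft_le s : \sum_a `|softmax phi1 s a - softmax phi s a| <= k.
Proof. exact: gibbs_lipschitz (vk s). Qed.

Let rsoft_le s :
  \sum_a `|softmax phi1 s a - softmax phi s a - dsoftmax phi v s a| <= 2 * k ^+ 2.
Proof. exact: gibbs_expansion (vk s). Qed.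

(** [f] will bound the first-order move of [Q / lambda], and [h] its second-order remainder; both
    have absorbed [Amax / lambda <= 1 / 2]. *)
Let f := gamma * k / (2 * g).
Let h := gamma * k ^+ 2 / g ^+ 2.

Let Amax_lambda : Amax / lambda <= 1 / 2.
Proof. by rewrite ler_pdivrMr //; move: hlambdaA; lra. Qed.

Let q_scale : gamma * (k * Amax) / g / lambda <= f.
Proof.
rewrite (_ : _ / lambda = gamma * k / g * (Amax / lambda)); last first.
  by field; rewrite !gt_eqF.
rewrite (_ : f = gamma * k / g * (1 / 2)); last by rewrite /f; field; rewrite gt_eqF.
by rewrite ler_wpM2l // divr_ge0 ?(ltW g1') // mulr_ge0 // ltW.
Qed.

Let lambda_norm : `|lambda^-1| = lambda^-1.
Proof. by rewrite gtr0_norm // invr_gt0. Qed.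

Let dx_le s a : `|dscaled_q phi v s a| <= f.
Proof.
rewrite normrM lambda_norm; apply: le_trans q_scale.
rewrite ler_wpM2r ?invr_ge0 ?(ltW hlambda) //.
apply: dq_le => //; by move=> s0; exact: softmax_dist.
Qed.

Let x_le s a : `|scaled_q phi1 s a - scaled_q phi s a| <= f.
Proof.
rewrite -mulrBl normrM lambda_norm; apply: le_trans q_scale.
rewrite ler_wpM2r ?invr_ge0 ?(ltW hlambda) //.
apply: qvalue_lipschitz => //; by move=> s'; exact: softmax_dist.
Qed.

Let rx_le s a :
  `|scaled_q phi1 s a - scaled_q phi s a - dscaled_q phi v s a| <= h.
Proof.
rewrite -!mulrBl normrM lambda_norm.
apply: (@le_trans _ _ (gamma * (2 * k ^+ 2 * Amax +
    k * (gamma * (k * Amax) / g)) / g / lambda)).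
  rewrite ler_wpM2r ?invr_ge0 ?(ltW hlambda) //.
  apply: qvalue_expansion => //; by move=> s'; exact: softmax_dist.
(* This uses [2 * g + gamma = 1 + g]; then [(1 + g) / 2 <= 1]. *)
rewrite (_ : _ / lambda = h * ((1 + g) * (Amax / lambda))); last first.
  by rewrite /h /g; field; rewrite !gt_eqF.
rewrite -[leRHS]mulr1 ler_wpM2l //.
  by rewrite /h divr_ge0 ?mulr_ge0 ?sqr_ge0 // ltW.
apply: le_trans (ler_wpM2l _ Amax_lambda) _; move: g0 g1'; rewrite /g; lra.
Qed.

(** A single factor [1 / g] covers the direct move of the parameter and the induced move of
    [Q / lambda]. *)
Let efk : k + f <= k / g.
Proof.
rewrite -subr_ge0 (_ : _ - _ = gamma * k / (2 * g)).
  by rewrite divr_ge0 ?mulr_ge0 // ltW.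
by rewrite /f /g; field; rewrite gt_eqF.
Qed.

Let f0 : 0 <= f. Proof. exact: le_trans (dx_le point point). Qed.

Let alg_formulaD2 s : alg_formula D2 phi1 s = gibbs (fun a =>
  (phi s a + scaled_q phi s a) + (v s a + (scaled_q phi1 s a - scaled_q phi s a))).
Proof.
congr gibbs; apply/funext => a.
have shift (x y z t : R) : x + y + z = x + t + (y + (z - t)) by ring.
exact: shift.
Qed.

Lemma sum_dalg i s : \sum_a dalg i phi v s a = 0.
Proof.
case: i => /=; last by apply: sum_tilt; exact: (alg_formula_dist D2 phi s).
apply: sum_reciprocal_tilt; first by move=> a; exact: gap.
exact: (alg_formula_dist D1 phi s).
Qed.

Lemma dalg_le i s : \sum_a `|dalg i phi v s a| <= rate i * k / g.
Proof.
rewrite -mulrA; case: i => /=.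
  apply: le_trans (ler_wpM2l _ efk) => //.
  apply: reciprocal_tilt_l1 => //.
  exact: (alg_formula_dist D1 phi s).
rewrite mul1r; apply: tilt_l1; first exact: (alg_formula_dist D2 phi s).
move=> a; apply: le_trans efk; apply: le_trans (ler_normD _ _) _.
by rewrite lerD.
Qed.

Lemma alg_formula_lipschitz i s :
  \sum_a `|alg_formula i phi1 s a - alg_formula i phi s a| <= rate i * k / g.
Proof.
rewrite -mulrA; case: i; last first.
  rewrite alg_formulaD2 mul1r; apply: gibbs_lipschitz => a; apply: le_trans efk.
  by apply: le_trans (ler_normD _ _) _; rewrite lerD.
rewrite /=; apply: le_trans (ler_wpM2l _ efk) => //.
apply: reciprocal_tilting_lipschitz => //.
- exact: (alg_formula_dist D1 phi s).
- exact: (alg_formula_dist D1 phi1 s).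
Qed.

(** Origin of the constants: for [D2], [3 = 2 + 1] from the softmax remainder and from [rx]; for
    [D1], [76 = 8 + 64 + 4] from the three terms of [reciprocal_tilting_expansion]. *)
Lemma alg_formula_expansion i s :
  \sum_a `|alg_formula i phi1 s a - alg_formula i phi s a - dalg i phi v s a| <=
  curvature i * k ^+ 2 / g ^+ 2.
Proof.
have gle1 : g <= 1 by rewrite /g; have := ltW g0; lra.
have g2 : g ^+ 2 <= 1 by rewrite exprn_ile1 // ltW.
have k2 : 0 <= k ^+ 2 / g ^+ 2 by rewrite divr_ge0 ?sqr_ge0.
have k2g : k ^+ 2 <= k ^+ 2 / g ^+ 2.
  by rewrite ler_pdivlMr ?exprn_gt0 // ler_piMr // sqr_ge0.
have hk : h <= k ^+ 2 / g ^+ 2.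
  by rewrite /h -mulrA ler_piMl //; case/andP: hgamma => _ /ltW.
case: i; last first.
  pose p0 := alg_formula D2 phi s.
  pose dx a := v s a + dscaled_q phi v s a.
  pose rx a := scaled_q phi1 s a - scaled_q phi s a - dscaled_q phi v s a.
  pose w a := v s a + (scaled_q phi1 s a - scaled_q phi s a).
  have wk a : `|w a| <= k / g.
    by apply: le_trans efk; apply: le_trans (ler_normD _ _) _; rewrite lerD.
  (* The exponent really moves by [w], whereas [dalg] uses its linear part [dx]; the discrepancy
     [rx] is second order. *)
  have dE a : dalg D2 phi v s a = tilt p0 w a - tilt p0 rx a.
    rewrite -[LHS]/(tilt p0 dx a).
    have wE : w = fun a => 1 * dx a + rx a.
      have shift (x y z : R) : x + y = 1 * (x + z) + (y - z) by ring.
      by apply/funext => b; exact: shift.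
    by rewrite wE tilt_linear mul1r addrK.
  rewrite alg_formulaD2.
  apply: (@le_trans _ _ (\sum_a (`|gibbs (fun b => phi s b + scaled_q phi s b + w b) a -
      p0 a - tilt p0 w a| + `|tilt p0 rx a|))).
    apply: ler_sum => a _; apply: le_trans (ler_normD _ _).
    by rewrite dE opprD opprK addrA.
  rewrite big_split /=; have H1 u := gibbs_expansion u wk.
  have H2 : \sum_a `|tilt p0 rx a| <= h.
    by apply: tilt_l1; [exact: gibbs_dist | move=> a; exact: rx_le].
  apply: le_trans (lerD (H1 _) H2) _; rewrite expr_div_n -mulrA; lra.
rewrite /=; apply: le_trans (@reciprocal_tilting_expansion _ _ _ _ _ _ _ _ _ _
    k f (2 * k ^+ 2) h _ _ _ _ (dsoft_le s) (dx_le s) (soft_le s) (x_le s)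
    (rsoft_le s) (rx_le s)) _.
- by move=> a; exact: gap.
- by move=> a; exact: gap.
- exact: (alg_formula_dist D1 phi s).
- exact: (alg_formula_dist D1 phi1 s).
have kg0 : 0 <= k / g by rewrite divr_ge0 // ltW.
have H : (k + f) * (4 * k + 2 * f) <= 4 * (k ^+ 2 / g ^+ 2).
  rewrite (_ : 4 * (k ^+ 2 / g ^+ 2) = (k / g) * (4 * (k / g))); last first.
    by field; rewrite gt_eqF.
  by apply: ler_pM => //; have := efk; have := k0; have := f0; lra.
rewrite -(mulrA 16) -mulrA; lra.
Qed.

End Increment.

Section RewardExpansion.
Variables (i : divergence) (phi v : S -> A -> R) (k : R).
Hypothesis vk : forall s a, `|v s a| <= k.

Definition dadapted (i : divergence) phi v : R :=
  dreward gamma M (alg_formula i phi) (dalg i phi v).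

(** [Abar] stays free so that the smaller of two advantage bounds can be inserted later. *)
Lemma dadapted_le Abar :
  (forall phi s a, `|advantage M gamma (alg_formula i phi) s a| <= Abar) ->
  `|dadapted i phi v| <= rate i * Abar / (1 - gamma) ^+ 2 * k.
Proof.
move=> HA.
rewrite (_ : _ * k = rate i * k / (1 - gamma) * Abar / (1 - gamma)); last first.
  by field; rewrite gt_eqF.
apply: dreward_le => // [s|s|s]; first exact: alg_formula_dist.
  exact: sum_dalg.
exact: dalg_le.
Qed.

(** The advantage bound inserted is [rmax / (1 - gamma)], which makes the coefficient proportional
    to [rmax] and free of [Amax]. *)
Lemma dadapted_expansion :
  `|total_reward M gamma (alg i gamma lambda (fun s a => phi s a + v s a) M) -
    total_reward M gamma (alg i gamma lambda phi M) - dadapted i phi v| <=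
  rmax * (curvature i / (1 - gamma) ^+ 4 +
          gamma * rate i ^+ 2 / (1 - gamma) ^+ 5) * k ^+ 2.
Proof.
have Abar_le s a :
    `|advantage M gamma (alg_formula i phi) s a| <= rmax / (1 - gamma).
  by apply: advantage_le => // s'; exact: alg_formula_dist.
have := total_reward_expansion hgamma (alg_formula_dist i phi) Abar_le
  (alg_formula_dist i _) (sum_dalg phi v i)
  (alg_formula_lipschitz phi vk i) (alg_formula_expansion phi vk i).
rewrite !algE => /le_trans; apply; rewrite le_eqVlt; apply/orP; left; apply/eqP.
by field; rewrite gt_eqF.
Qed.

Lemma dadapted_linear (c : R) v' :
  dadapted i phi (fun s a => c * v s a + v' s a) =
  c * dadapted i phi v + dadapted i phi v'.
Proof.
rewrite /dadapted -dreward_linear //; last by move=> s; exact: alg_formula_dist.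
congr dreward; apply/funext => s; apply/funext => a; exact: dalg_linear.
Qed.

End RewardExpansion.

End WithinTaskAdaptation.

(** * Gradients *)

Section FirstOrderExpansions.
Variables (R : realType) (S A : finPointedType).
Implicit Types (F D : (S -> A -> R) -> R) (phi v g : S -> A -> R).

Definition dotp g v : R := \sum_s \sum_a g s a * v s a.

Definition unit_dir (x : S * A) : S -> A -> R := fun s a => ((s, a) == x)%:R.

Lemma dotpp g : dotp g g = sqnorm g.
Proof. by []. Qed.

Lemma sqnorm_ge0 g : 0 <= sqnorm g.
Proof. by apply: sumr_ge0 => s _; apply: sumr_ge0 => a _; exact: sqr_ge0. Qed.

Lemma coord_le_norm v s a : `|v s a| <= Num.sqrt (sqnorm v).
Proof.
rewrite -sqrtr_sqr ler_wsqrtr // /sqnorm (bigD1 s) //= (bigD1 a) //= -addrA lerDl.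
rewrite addr_ge0 //; first by apply: sumr_ge0 => b _; exact: sqr_ge0.
by apply: sumr_ge0 => t _; apply: sumr_ge0 => b _; exact: sqr_ge0.
Qed.

Lemma sqnormZ (c : R) v : sqnorm (fun s a => c * v s a) = c ^+ 2 * sqnorm v.
Proof.
rewrite /sqnorm mulr_sumr; apply: eq_bigr => s _; rewrite mulr_sumr.
by apply: eq_bigr => a _; rewrite exprMn.
Qed.

Lemma dotpZ g (c : R) v : dotp g (fun s a => c * v s a) = c * dotp g v.
Proof.
rewrite /dotp mulr_sumr; apply: eq_bigr => s _; rewrite mulr_sumr.
by apply: eq_bigr => a _; rewrite mulrCA.
Qed.

Lemma dotp_unit g s a : dotp g (unit_dir (s, a)) = g s a.
Proof.
rewrite /dotp (bigD1 s) //= (bigD1 a) //= /unit_dir eqxx mulr1.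
rewrite !big1 ?addr0 // => [t ts|b ba].
  by rewrite big1 // => b _; rewrite xpair_eqE (negbTE ts) mulr0.
by rewrite xpair_eqE (negbTE ba) andbF mulr0.
Qed.

Lemma linear_dotp D v :
  (forall (c : R) v v', D (fun s a => c * v s a + v' s a) = c * D v + D v') ->
  D v = dotp (fun s a => D (unit_dir (s, a))) v.
Proof.
move=> Dlin.
(* Linearity is packed in one identity; [c = -1] at zero directions makes its right side cancel. *)
have D0 : D (fun _ _ => 0) = 0.
  have := Dlin (-1) (fun _ _ => 0) (fun _ _ => 0); rewrite mulr0 addr0 mulN1r addNr.
  by [].
have Dsum (r : seq (S * A)) :
    D (fun s a => \sum_(x <- r) v x.1 x.2 * unit_dir x s a) =
    \sum_(x <- r) v x.1 x.2 * D (unit_dir x).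
  elim: r => [|x r IH].
    by rewrite big_nil -[RHS]D0; congr D; apply/funext => s; apply/funext => a;
      rewrite big_nil.
  rewrite big_cons -IH -Dlin; congr D; apply/funext => s; apply/funext => a.
  by rewrite big_cons.
rewrite /dotp; transitivity (\sum_x v x.1 x.2 * D (unit_dir x)); last first.
  rewrite sum_pairE; apply: eq_bigr => s _; apply: eq_bigr => a _.
  exact: mulrC.
rewrite -Dsum; congr D; apply/funext => s; apply/funext => a.
rewrite (bigD1 (s, a)) //= /unit_dir eqxx mulr1 big1 ?addr0 // => x xsa.
by rewrite eq_sym (negbTE xsa) mulr0.
Qed.

Lemma derive1_quadratic_bound (f : R -> R) (l H : R) :
  (forall h, `|f h - f 0 - h * l| <= H * h ^+ 2) -> derive1 f 0 = l.
Proof.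
move=> fH; apply: cvg_lim => //; apply/cvgrPdist_le => e e0.
have H0 : 0 <= H.
  by have := fH 1; rewrite expr1n mulr1; apply: le_trans.
near=> h.
have h0 : h != 0 by near: h; exact: nbhs_dnbhs_neq.
(* [H + 1] rather than [H], which may be 0. *)
have he : `|h| <= e / (H + 1).
  near: h; apply: dnbhs0_le; rewrite divr_gt0 //; lra.
have -> : l - h^-1 *: (f (h + 0) - f 0) = - (h^-1 * (f h - f 0 - h * l)).
  by rewrite addr0 /GRing.scale /=; field.
rewrite normrN normrM normfV mulrC ler_pdivrMr ?normr_gt0 //.
apply: le_trans (fH h) _; rewrite -real_normK ?num_real // expr2 mulrA.
rewrite ler_wpM2r //; apply: le_trans (ler_wpM2l H0 he) _.
rewrite mulrA ler_pdivrMr; last lra.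
by rewrite mulrC ler_wpM2l ?(ltW e0) //; lra.
Unshelve. all: by end_near. Qed.

Lemma grad_of_expansion F phi g (H : R) :
  (forall v, `|F (fun s a => phi s a + v s a) - F phi - dotp g v| <= H * sqnorm v) ->
  grad F phi = g.
Proof.
move=> FH; apply/funext => s; apply/funext => a.
apply: (@derive1_quadratic_bound _ _ (H * sqnorm (unit_dir (s, a)))) => h.
have := FH (fun s' a' => h * unit_dir (s, a) s' a').
rewrite sqnormZ dotpZ dotp_unit mulrCA [X in _ <= X]mulrC.
rewrite (_ : (fun s' a' => phi s' a' + 0 * _) = phi) //.
by apply/funext => s'; apply/funext => a'; rewrite mul0r addr0.
Qed.

Lemma linear_expansion_grad F D phi (H : R) : 0 <= H ->
  (forall (c : R) v v', D (fun s a => c * v s a + v' s a) = c * D v + D v') ->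
  (forall v k, (forall s a, `|v s a| <= k) ->
    `|F (fun s a => phi s a + v s a) - F phi - D v| <= H * k ^+ 2) ->
  forall v, D v = dotp (grad F phi) v /\
    `|F (fun s a => phi s a + v s a) - F phi - dotp (grad F phi) v| <= H * sqnorm v.
Proof.
move=> H0 Dlin DH; pose g s a := D (unit_dir (s, a)).
have Dg v : D v = dotp g v by exact: linear_dotp.
have gH v : `|F (fun s a => phi s a + v s a) - F phi - dotp g v| <= H * sqnorm v.
  rewrite -Dg -[X in _ <= _ * X]sqr_sqrtr ?sqnorm_ge0 //.
  by apply: DH => s a; exact: coord_le_norm.
by rewrite (grad_of_expansion gH).
Qed.

(** Test against [g] itself: its sup norm is at most its Euclidean norm [n], so [n ^+ 2 <= G * n],
    without any dimension factor. *)
Lemma sqnorm_dual g (G : R) :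
  (forall v k, (forall s a, `|v s a| <= k) -> `|dotp g v| <= G * k) ->
  sqnorm g <= G ^+ 2.
Proof.
move=> gG; have := gG g _ (coord_le_norm g); rewrite dotpp.
rewrite ger0_norm ?sqnorm_ge0 // -{1}[sqnorm g]sqr_sqrtr ?sqnorm_ge0 // => Hn.
have n0 : 0 <= Num.sqrt (sqnorm g) by exact: sqrtr_ge0.
rewrite -[sqnorm g]sqr_sqrtr ?sqnorm_ge0 //.
move: n0; rewrite le_eqVlt => /predU1P[<-|n0]; first by rewrite expr0n /= sqr_ge0.
have : Num.sqrt (sqnorm g) <= G by rewrite -(ler_pM2r n0) -expr2.
by move=> nG; rewrite lerXn2r ?nnegrE ?(ltW n0) // (le_trans (ltW n0)).
Qed.

End FirstOrderExpansions.

(** * Smoothness and gradient bound of the adapted reward *)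

Section AdaptedGradient.
Variables (R : realType) (S A : finPointedType) (rmax gamma lambda Amax : R).
Hypotheses (hgamma : 0 < gamma < 1) (hlambda : 0 < lambda).
Variable M : @mdp R S A rmax.
Hypothesis A1 : forall theta s a, `|advantage M gamma (softmax theta) s a| <= Amax.
Hypothesis hlambdaA : 2 * Amax <= lambda.
Variable i : divergence.

Let F phi := total_reward M gamma (alg i gamma lambda phi M).

(** Half of what is usually called the smoothness constant: no factor 1/2 accompanies it in the
    remainder bound. *)
Definition smoothness (R : realType) (i : divergence) (rmax gamma : R) : R :=
  rmax * (curvature R i / (1 - gamma) ^+ 4 +
          gamma * rate R i ^+ 2 / (1 - gamma) ^+ 5).

Let g0 : 0 < gamma. Proof. by case/andP: hgamma. Qed.
Let g1' : 0 < 1 - gamma. Proof. by rewrite subr_gt0; case/andP: hgamma. Qed.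

Lemma smoothness_ge0 : 0 <= smoothness i rmax gamma.
Proof.
rewrite mulr_ge0 ?(rmax_ge0 M) // addr_ge0 // divr_ge0 ?exprn_ge0 ?(ltW g1') //.
  by case: i.
by rewrite mulr_ge0 ?sqr_ge0 // ltW.
Qed.

Let expansion phi v :
  dadapted gamma lambda M i phi v = dotp (grad F phi) v /\
  `|F (fun s a => phi s a + v s a) - F phi - dotp (grad F phi) v| <=
    smoothness i rmax gamma * sqnorm v.
Proof.
apply: linear_expansion_grad => [|c u u'|u k uk]; first exact: smoothness_ge0.
  exact: dadapted_linear.
exact: (dadapted_expansion (Amax := Amax)).
Qed.

Lemma adapted_reward_expansion phi v :
  `|F (fun s a => phi s a + v s a) - F phi - dotp (grad F phi) v| <=
  smoothness i rmax gamma * sqnorm v.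
Proof. exact: (expansion phi v).2. Qed.

Lemma adapted_grad_le phi Abar :
  (forall phi s a, `|advantage M gamma (alg_formula gamma lambda M i phi) s a| <= Abar) ->
  sqnorm (grad F phi) <= (rate R i * Abar / (1 - gamma) ^+ 2) ^+ 2.
Proof.
move=> HA; apply: sqnorm_dual => v k vk; rewrite -(expansion phi v).1.
exact: (dadapted_le (Amax := Amax)).
Qed.

End AdaptedGradient.

(** * Joint measurability in the task and the parameters *)

Section JointMeasurability.
Variables (R : realType) (d : measure_display) (W : measurableType d).

Notation mfun f := (measurable_fun [set: W] f).

Lemma measurable_posV (f : W -> R) : (forall w, 0 < f w) ->
  mfun f -> mfun (fun w => (f w)^-1).
Proof.
move=> f0 mf; rewrite (_ : (fun w => _) = (fun w => expR (- ln (f w)))).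
  apply: measurableT_comp; first exact: measurable_expR.
  by apply: measurableT_comp => //; apply: measurableT_comp => //; exact: measurable_ln.
by apply/funext => w; rewrite expRN lnK // posrE.
Qed.

Lemma measurable_wsum (I : finType) (f g : W -> I -> R) :
  (forall x, mfun (f ^~ x)) -> (forall x, mfun (g ^~ x)) ->
  mfun (fun w => \sum_x f w x * g w x).
Proof.
by move=> mf mg; apply: measurable_sum => x; exact: measurable_funM.
Qed.

Lemma measurable_disc (X : finType) (gamma : R) (K : W -> X -> X -> R)
    (b : W -> X -> R) x : 0 < gamma < 1 ->
  (forall w x, is_dist (K w x)) -> (forall x y, mfun (fun w => K w x y)) ->
  (forall x, mfun (b ^~ x)) -> mfun (fun w => disc gamma (K w) (b w) x).
Proof.
move=> hg Kd mK mb.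
apply: (@measurable_fun_cvg _ _ _ _
  (fun n w => series (disc_term gamma (K w) (b w) x) n)) => [n|w _]; last first.
  exact: is_cvg_disc.
apply: measurable_sum => t; apply: measurable_funM => //.
elim: t x => [|t IH] x //=; exact: measurable_wsum.
Qed.

Variables (S A : finPointedType) (rmax gamma lambda : R).
Hypothesis hgamma : 0 < gamma < 1.
Variable M : W -> @mdp R S A rmax.
Hypothesis minit : forall s, mfun (fun w => init (M w) s).
Hypothesis mtrans : forall s a s', mfun (fun w => trans (M w) s a s').
Hypothesis mreward : forall s a s', mfun (fun w => reward (M w) s a s').

Lemma measurable_qvalue (p : W -> S -> A -> R) s a :
  (forall w s, is_dist (p w s)) -> (forall s a, mfun (fun w => p w s a)) ->
  mfun (fun w => qvalue (M w) gamma (p w) s a).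
Proof.
move=> pd mp; under eq_fun do rewrite qvalueE //.
apply: measurable_disc => // [w x|x y|x]; first exact: sa_kernel_dist.
  exact: measurable_funM.
by apply: (@measurable_wsum _ (fun w s' => _) (fun w s' => _)).
Qed.

Lemma measurable_total_reward (p : W -> S -> A -> R) :
  (forall w s, is_dist (p w s)) -> (forall s a, mfun (fun w => p w s a)) ->
  mfun (fun w => total_reward (M w) gamma (p w)).
Proof.
move=> pd mp; rewrite /total_reward.
apply: (@measurable_wsum _ (fun w s => _) (fun w s => _)) => // s.
under eq_fun do rewrite valueE //.
apply: (@measurable_wsum _ (fun w a => _) (fun w a => _)) => // a.
exact: measurable_qvalue.
Qed.

Lemma measurable_gibbs (u : W -> A -> R) a : (forall a, mfun (u ^~ a)) ->
  mfun (fun w => gibbs (u w) a).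
Proof.
move=> mu; have me b : mfun (fun w => expR (u w b)).
  by apply: measurableT_comp; [exact: measurable_expR | exact: mu].
apply: measurable_funM => //; apply: measurable_posV.
  by move=> w; exact: gibbs_mass_gt0.
exact: measurable_sum.
Qed.

(** [normalizer] is a choice and hides its dependence on [w]; [normalizer_le] expresses each set
    where it exceeds [c] through measurable functions. *)
Lemma measurable_normalizer (p x : W -> A -> R) :
  (forall w, is_dist (p w)) -> (forall w a, 0 < p w a) ->
  (forall w a, `|x w a - \sum_b p w b * x w b| <= 1 / 2) ->
  (forall a, mfun (p ^~ a)) -> (forall a, mfun (x ^~ a)) ->
  mfun (fun w => normalizer (p w) (x w)).
Proof.
move=> pd p0 xm mp mx.
have mm : mfun (fun w => \sum_b p w b * x w b) by exact: measurable_wsum.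
apply: (measurability _ (RGenOInfty.measurableE R)) => _ [_ [c ->] <-].
(* Truncation at 1/2 keeps the denominators positive for every [w]; it is inactive where the average
   plus 1 is at most [c]. *)
rewrite setTI; pose gap w a := Num.max (c - x w a) (1 / 2).
have gap0 w a : 0 < gap w a by rewrite lt_max orbC divr_gt0.
rewrite (_ : _ @^-1` _ = ~` ([set w | \sum_b p w b * x w b + 1 <= c] `&`
    [set w | \sum_b p w b * (gap w b)^-1 <= 1])).
  apply: measurableC; apply: measurableI; rewrite -[X in measurable X]setTI;
    apply: measurable_fun_le => //; first exact: measurable_funD.
  apply: (@measurable_wsum _ _ (fun w b => (gap w b)^-1)) => // b.
  apply: measurable_posV => //; apply: measurable_maxr => //.
  exact: measurable_funB.
have key w : (normalizer (p w) (x w) <= c) =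
    (\sum_b p w b * x w b + 1 <= c) && (\sum_b p w b * (gap w b)^-1 <= 1).
  rewrite normalizer_le //; case: leP => //= mc; congr (_ <= _).
  apply: eq_bigr => b _; rewrite /gap max_l //.
  by have := xm w b; rewrite ler_norml => /andP[_]; lra.
apply/seteqP; split=> w /=; rewrite in_itv /= andbT ltNge key.
  by move=> /negP nc mc; apply: nc; apply/andP.
by move=> nc; apply/negP => /andP.
Qed.

Lemma measurable_alg_formula (phi : W -> S -> A -> R) i s a Amax :
  0 < lambda -> 2 * Amax <= lambda ->
  (forall w theta s a, `|advantage (M w) gamma (softmax theta) s a| <= Amax) ->
  (forall s a, mfun (fun w => phi w s a)) ->
  mfun (fun w => alg_formula gamma lambda (M w) i (phi w) s a).
Proof.
move=> l0 lA HA mphi.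
have msoft t b : mfun (fun w => softmax (phi w) t b).
  exact: (@measurable_gibbs (fun w b => phi w t b)).
have mq t b : mfun (fun w => scaled_q gamma lambda (M w) (phi w) t b).
  apply: measurable_funM => //; apply: measurable_qvalue => // w t'.
  exact: softmax_dist.
case: i => /=; last first.
  by apply: (@measurable_gibbs (fun w b => _)) => b; exact: measurable_funD.
have xm w := scaled_q_centered hgamma l0 (HA w) lA (phi w) s.
have pd w := softmax_dist (phi w) s; have p0 w := softmax_gt0 (phi w) s.
apply: measurable_funM => //; apply: measurable_posV.
  by move=> w; have /andP[] := normalizer_gap (pd w) (xm w) a; lra.
by apply: measurable_funB => //; exact: measurable_normalizer.
Qed.

End JointMeasurability.

(** * Bounded random variables and independence of the past *)

Section BoundedAverages.
Variables (R : realType) (d : measure_display) (W : measurableType d).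
Variable P : probability W R.
Implicit Types X Y : W -> R.

Definition bounded_measurable X : Prop :=
  measurable_fun [set: W] X /\ exists B, forall w, `|X w| <= B.

Definition avg X : R := Rintegral P [set: W] X.

Lemma bounded_measurable_cst (c : R) : bounded_measurable (fun=> c).
Proof. by split=> //; exists `|c|. Qed.

Lemma bounded_measurableD X Y : bounded_measurable X -> bounded_measurable Y ->
  bounded_measurable (fun w => X w + Y w).
Proof.
move=> [mX [B XB]] [mY [C YC]]; split; first exact: measurable_funD.
by exists (B + C) => w; apply: le_trans (ler_normD _ _) _; exact: lerD.
Qed.

Lemma bounded_measurableM X Y : bounded_measurable X -> bounded_measurable Y ->
  bounded_measurable (fun w => X w * Y w).
Proof.
move=> [mX [B XB]] [mY [C YC]]; split; first exact: measurable_funM.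
by exists (B * C) => w; rewrite normrM ler_pM.
Qed.

Lemma bounded_measurableZ (c : R) X : bounded_measurable X ->
  bounded_measurable (fun w => c * X w).
Proof. exact/bounded_measurableM/bounded_measurable_cst. Qed.

Lemma bounded_measurableB X Y : bounded_measurable X -> bounded_measurable Y ->
  bounded_measurable (fun w => X w - Y w).
Proof.
move=> [mX [B XB]] [mY [C YC]]; split; first exact: measurable_funB.
by exists (B + C) => w; apply: le_trans (ler_normB _ _) _; exact: lerD.
Qed.

Lemma bounded_measurable_sum (I : finType) (F : I -> W -> R) :
  (forall x, bounded_measurable (F x)) ->
  bounded_measurable (fun w => \sum_x F x w).
Proof.
move=> HF; elim: (index_enum I) => [|x s IH].
  by under eq_fun do rewrite big_nil; exact: bounded_measurable_cst.
by under eq_fun do rewrite big_cons; exact: bounded_measurableD.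
Qed.

Lemma bounded_measurable_integrable X : bounded_measurable X ->
  P.-integrable [set: W] (EFin \o X).
Proof.
have PT : (P [set: W] < +oo)%E by rewrite probability_setT ltry.
move=> [mX [B XB]]; apply: measurable_bounded_integrable => //.
by exists B; split; [exact: num_real | move=> M BM w _; exact: le_trans (ltW BM)].
Qed.

Lemma avg_fineK X : bounded_measurable X ->
  (\int[P]_w (X w)%:E = (avg X)%:E)%E.
Proof.
move=> bX; rewrite /avg /Rintegral fineK //.
by apply: integrable_fin_num => //; exact: bounded_measurable_integrable.
Qed.

Lemma expectation_avg X : bounded_measurable X -> ('E_P[X] = (avg X)%:E)%E.
Proof. by move=> bX; rewrite unlock avg_fineK. Qed.

Lemma fine_expectation X : fine 'E_P[X] = avg X.
Proof. by rewrite unlock. Qed.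

Lemma avg_cst (c : R) : avg (fun=> c) = c.
Proof.
have P1 : fine (P [set: W]) = 1 by rewrite probability_setT.
by rewrite /avg Rintegral_cst // -[RHS]mulr1; congr (_ * _).
Qed.

Lemma avgD X Y : bounded_measurable X -> bounded_measurable Y ->
  avg (fun w => X w + Y w) = avg X + avg Y.
Proof. by move=> bX bY; rewrite /avg RintegralD //; exact: bounded_measurable_integrable. Qed.

Lemma avgB X Y : bounded_measurable X -> bounded_measurable Y ->
  avg (fun w => X w - Y w) = avg X - avg Y.
Proof. by move=> bX bY; rewrite /avg RintegralB //; exact: bounded_measurable_integrable. Qed.

Lemma avgZ (c : R) X : bounded_measurable X -> avg (fun w => c * X w) = c * avg X.
Proof. by move=> bX; rewrite /avg RintegralZl //; exact: bounded_measurable_integrable. Qed.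

Lemma avg_sum (I : finType) (F : I -> W -> R) :
  (forall x, bounded_measurable (F x)) ->
  avg (fun w => \sum_x F x w) = \sum_x avg (F x).
Proof.
move=> HF; suff [-> _] : avg (fun w => \sum_x F x w) = \sum_x avg (F x) /\
    bounded_measurable (fun w => \sum_x F x w) by [].
elim: (index_enum I) => [|x s [IH1 IH2]].
  under eq_fun do rewrite big_nil; rewrite avg_cst big_nil.
  by split=> //; exact: bounded_measurable_cst.
under eq_fun do rewrite big_cons; rewrite avgD // IH1 big_cons.
by split=> //; exact: bounded_measurableD.
Qed.

Lemma avg_le X Y : bounded_measurable X -> bounded_measurable Y ->
  (forall w, X w <= Y w) -> avg X <= avg Y.
Proof. by move=> bX bY XY; apply: le_Rintegral => //; exact: bounded_measurable_integrable. Qed.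

Lemma avg_norm_le X B : bounded_measurable X -> (forall w, `|X w| <= B) ->
  `|avg X| <= B.
Proof.
move=> bX XB; rewrite ler_norml; apply/andP; split;
  [rewrite -[leLHS]avg_cst | rewrite -[leRHS]avg_cst];
  by apply: avg_le => // [|w]; [exact: bounded_measurable_cst |
    have := XB w; rewrite ler_norml => /andP[]].
Qed.

End BoundedAverages.

Lemma bounded_measurable_section (R : realType) (d d' : measure_display)
    (W : measurableType d) (Y : measurableType d') (U : W -> Y -> R) (B : R) w :
  measurable_fun [set: W * Y] (fun x => U x.1 x.2) ->
  (forall w y, `|U w y| <= B) -> bounded_measurable (U w).
Proof.
move=> mU UB; split; last by exists B.
have -> : U w = (fun x => U x.1 x.2) \o (pair w) by [].
by apply: measurableT_comp => //; exact: pair1_measurable.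
Qed.

(** Adding [B] makes a function bounded by [B] nonnegative; Tonelli and the change of variables are
    applied below to such shifted functions. *)
Lemma integral_shift (R : realType) (d : measure_display) (W : measurableType d)
    (P : probability W R) (X : W -> R) (B : R) : bounded_measurable X ->
  (\int[P]_w (X w + B)%:E = (avg P X + B)%:E)%E.
Proof.
move=> bX; have bB := bounded_measurable_cst W B.
rewrite avg_fineK; last exact: bounded_measurableD.
by rewrite avgD // avg_cst.
Qed.

Lemma measurable_avg (R : realType) (d d' : measure_display)
    (W : measurableType d) (Y : measurableType d') (mu : probability Y R)
    (U : W -> Y -> R) (B : R) :
  measurable_fun [set: W * Y] (fun x => U x.1 x.2) ->
  (forall w y, `|U w y| <= B) ->
  measurable_fun [set: W] (fun w => avg mu (U w)).
Proof.
move=> mU UB; pose V (x : W * Y) := (U x.1 x.2 + B)%:E.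
have mV : measurable_fun [set: W * Y] V.
  by apply/measurable_EFinP; exact: measurable_funD.
have V0 x : (0 <= V x)%E.
  by rewrite lee_fin; have := UB x.1 x.2; rewrite ler_norml => /andP[]; lra.
have := measurable_fun_fubini_tonelli_F (m2 := mu) V mV V0.
rewrite /fubini_F (_ : (fun x => _) = EFin \o (fun w => avg mu (U w) + B)).
  move=> /measurable_EFinP mF.
  rewrite (_ : (fun w => _) = (fun w => (avg mu (U w) + B) - B)).
    exact: measurable_funB.
  by apply/funext => w; rewrite addrK.
apply/funext => w /=; rewrite /V /= integral_shift //.
exact: bounded_measurable_section mU UB.
Qed.

(** As functions of [A] both sides are finite measures, [P] restricted to [E] and [P] scaled by
    [P E], and they agree on a generating pi-system. *)
Lemma pi_system_independence (R : realType) (d : measure_display)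
    (T : measurableType d) (P : probability T R) (G : set (set T)) (E : set T) :
  G `<=` measurable -> setI_closed G -> G setT -> measurable E ->
  (forall A, G A -> P (A `&` E) = (P A * P E)%E) ->
  forall A, <<s G >> A -> P (A `&` E) = (P A * P E)%E.
Proof.
move=> Gm GI GT mE HG A HA.
have PE0 : 0 <= fine (P E) by exact: fine_ge0.
pose f A := P (A `&` E).
have f0 : f set0 = 0%E by rewrite /f set0I measure0.
have f_ge0 (B : set T) : (0 <= f B)%E by exact: measure_ge0.
have f_sigma : semi_sigma_additive f.
  move=> F mF tF mU; rewrite /f setI_bigcupl.
  apply: measure_sigma_additive => [k|]; first exact: measurableI.
  exact: trivIset_setIr.
pose m1_mixin := isMeasure.Build _ _ _ f f0 f_ge0 f_sigma.
pose m1 : {measure set T -> \bar R} := HB.pack f m1_mixin.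
pose m2 := [the {measure set T -> \bar R} of mscale (NngNum PE0) P].
have m2E C : m2 C = (P C * P E)%E.
  by rewrite /m2 /mscale /= /mscale /= muleC fineK // fin_num_measure.
rewrite -m2E -[LHS]/(m1 A).
apply: (@g_sigma_algebra_measure_unique _ _ _ G Gm (fun=> setT) _ _ m1 m2) HA => //.
- by apply/seteqP; split=> // w _; exists 0%N.
- by move=> C GC; rewrite m2E; exact: HG.
- move=> _; rewrite /m1 /= /f setTI.
  by rewrite (le_lt_trans (probability_le1 _ _)) // ltry.
Qed.

(** * Independence of a draw from its past *)

Section Independence.
Variables (R : realType) (dG dO : measure_display).
Variables (Gamma : measurableType dG) (Omega : measurableType dO).
Variables (mu : probability Gamma R) (P : probability Omega R).
Variable tau : nat -> {mfun Omega >-> Gamma}.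
Hypothesis htau : iid P mu tau.
Variable t : nat.

Definition history_sets : set (set Omega) :=
  [set \bigcap_(k in [set k | (k < t)%N]) (tau k @^-1` B k) |
    B in [set B : nat -> set Gamma | forall k, measurable (B k)]].

(* [Omega] with the sigma-algebra generated by [tau 0], ..., [tau (t - 1)]. *)
Definition history := g_sigma_algebraType history_sets.

Let mpre k (B : set Gamma) : measurable B -> measurable (tau k @^-1` B).
Proof. by move=> mB; rewrite -[X in measurable X]setTI; exact: measurable_funP. Qed.

Let history_sets_measurable : history_sets `<=` measurable.
Proof.
by move=> _ [B mB <-]; apply: bigcap_measurableType => k _; exact: mpre.
Qed.

Lemma measurable_history_id : measurable_fun [set: Omega] (id : Omega -> history).
Proof.
apply: (@measurability _ _ _ history _ _ history_sets erefl).
move=> _ [A HA <-]; rewrite setTI; exact: history_sets_measurable.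
Qed.

Lemma measurable_history_tau k : (k < t)%N ->
  measurable_fun [set: history] (tau k : history -> Gamma).
Proof.
move=> kt _ B mB; rewrite setTI; apply: sub_sigma_algebra.
exists (fun j => if j == k then B else setT) => [j|].
  by case: ifP.
apply/seteqP; split=> w /= H; first by have := H k kt; rewrite /= eqxx.
by move=> j _ /=; case: eqP => [->|].
Qed.

Lemma history_setI : setI_closed history_sets.
Proof.
move=> _ _ [B mB <-] [C mC <-]; exists (fun k => B k `&` C k) => [k|].
  exact: measurableI.
apply/seteqP; split=> w.
  by move=> H; split=> k kt; have [] := H k kt.
by move=> [HB HC] k kt; split; [exact: HB | exact: HC].
Qed.

Lemma history_independent (A : set Omega) (B : set Gamma) :
  <<s history_sets >> A -> measurable B ->
  P (A `&` tau t @^-1` B) = (P A * mu B)%E.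
Proof.
move=> HA mB; have [Hmu Hind] := htau.
have PB k C : measurable C -> P (tau k @^-1` C) = mu C by exact: Hmu.
rewrite -(PB t B mB); apply: (pi_system_independence (G := history_sets)) HA => //.
- exact: history_setI.
- exists (fun=> setT) => //.
  by apply/seteqP; split=> // w _ k _.
- exact: mpre.
(* [C'] places [B] at index [t], so the intersection becomes one cylinder over [t.+1] indices and
   the product formula of [iid] applies. *)
move=> _ [C mC <-]; pose C' k := if k == t then B else C k.
have mC' k : measurable (C' k) by rewrite /C'; case: ifP.
have setE n : [set k | (k < n)%N] = [set` iota 0 n].
  by apply/seteqP; split=> k /=; rewrite mem_iota add0n.
have -> : \bigcap_(k in [set k | (k < t)%N]) (tau k @^-1` C k) `&` tau t @^-1` B =
    \bigcap_(k in [set k | (k < t.+1)%N]) (tau k @^-1` C' k).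
  apply/seteqP; split=> w /=.
    move=> [H HB] k /=; rewrite ltnS leq_eqVlt /C' => /predU1P[->|kt].
      by rewrite eqxx.
    by rewrite ltn_eqF //; exact: H.
  move=> H; split=> [k kt|].
    by have := H k; rewrite /= ltnS /C' ltn_eqF //; apply; exact: ltnW.
  by have := H t; rewrite /= ltnS /C' eqxx; apply.
rewrite !setE.
rewrite !Hind ?iota_uniq // -[in LHS]addn1 iotaD big_cat /= big_seq1.
rewrite /C' add0n eqxx; congr (_ * _)%E.
apply: eq_big_seq => k; rewrite mem_iota add0n => /andP[_ kt].
by rewrite ltn_eqF.
Qed.

(** Freezing lemma: the image of [P] under [w |-> (w, tau t w)] on [history * Gamma] is a product
    measure, by agreement on rectangles, and Tonelli integrates the new task out first. *)
Lemma avg_independent (U : history -> Gamma -> R) (B : R) :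
  measurable_fun [set: history * Gamma] (fun x => U x.1 x.2) ->
  (forall w y, `|U w y| <= B) ->
  avg P (fun w => U w (tau t w)) = avg P (fun w => avg mu (U w)).
Proof.
move=> mU UB; pose V (x : history * Gamma) := (U x.1 x.2 + B)%:E.
have mV : measurable_fun [set: history * Gamma] V.
  by apply/measurable_EFinP; exact: measurable_funD.
have V0 x : (0 <= V x)%E.
  by rewrite lee_fin; have := UB x.1 x.2; rewrite ler_norml => /andP[]; lra.
have mid := measurable_history_id.
pose J (w : Omega) : history * Gamma := (w, tau t w).
have mJ : measurable_fun [set: Omega] J.
  by apply/measurable_fun_pairP; split=> //; exact: measurable_funP.
pose id_mixin := isMeasurableFun.Build _ _ _ _ (id : Omega -> history) mid.
pose hid : {mfun Omega >-> history} := HB.pack (id : Omega -> history) id_mixin.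
pose J_mixin := isMeasurableFun.Build _ _ _ _ J mJ.
pose hJ : {mfun Omega >-> (history * Gamma)%type} := HB.pack J J_mixin.
pose Ph : probability history R := distribution P hid.
pose PJ : probability (history * Gamma)%type R := distribution P hJ.
have prodE X : measurable X -> (Ph \x mu)%E X = PJ X.
  apply: product_measure_unique => C D mC mD.
  by rewrite -(history_independent mC mD).
have bS w : bounded_measurable (U w) by exact: bounded_measurable_section mU UB.
have bJ : bounded_measurable (fun w : Omega => U w (tau t w)).
  split; last by exists B.
  exact: (measurableT_comp mU mJ).
have bA : bounded_measurable (fun w : Omega => avg mu (U w)).
  split; last by exists B => w; exact: avg_norm_le.
  exact: (measurableT_comp (measurable_avg mu mU UB) mid).
suff : ((avg P (fun w => U w (tau t w)) + B)%:E =
        (avg P (fun w => avg mu (U w)) + B)%:E)%E by move=> [] /addIr.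
rewrite -!integral_shift //.
transitivity (\int[PJ]_x V x)%E.
  by rewrite ge0_integral_pushforward.
transitivity (\int[(Ph \x mu)%E]_x V x)%E.
  by apply/esym/eq_measure_integral => X mX _; exact: prodE.
rewrite fubini_tonelli1 //.
have FE w : fubini_F mu V w = (avg mu (U w) + B)%:E.
  by rewrite /fubini_F /V /= integral_shift.
under eq_integral do rewrite FE.
rewrite ge0_integral_pushforward //.
  apply/measurable_EFinP; apply: measurable_funD => //.
  exact: (measurable_avg mu mU UB).
by move=> w _; rewrite -FE; apply: integral_ge0.
Qed.

End Independence.

(** * Stochastic gradient ascent *)

Section StochasticGradientAscent.
Variables (R : realType) (S A : finPointedType) (dG dO : measure_display).
Variables (Gamma : measurableType dG) (Omega : measurableType dO).
Variables (mu : probability Gamma R) (P : probability Omega R).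
Variable tau : nat -> {mfun Omega >-> Gamma}.
Hypothesis htau : iid P mu tau.
Variables (f : Gamma -> (S -> A -> R) -> R) (B H G : R).
Hypothesis f_itv : forall y phi, 0 <= f y phi <= B.
Hypothesis f_expansion : forall y phi v,
  `|f y (fun s a => phi s a + v s a) - f y phi - dotp (grad (f y) phi) v| <=
  H * sqnorm v.
Hypothesis G_ge0 : 0 <= G.
Hypothesis H_ge0 : 0 <= H.
Hypothesis f_grad : forall y phi, sqnorm (grad (f y) phi) <= G ^+ 2.
(** Quantified over the source space because it is applied on [Gamma], on [Omega] and on products
    with [Gamma]. *)
Hypothesis f_measurable : forall (d : measure_display) (W : measurableType d)
  (phi : W -> S -> A -> R) (y : W -> Gamma),
  (forall s a, measurable_fun [set: W] (fun w => phi w s a)) ->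
  measurable_fun [set: W] y -> measurable_fun [set: W] (fun w => f (y w) (phi w)).

Definition mean_objective (phi : S -> A -> R) : R :=
  fine 'E_mu[fun y => f y phi].

Fixpoint sgd_iter (alpha : R) (phi0 : S -> A -> R) (y : nat -> Gamma) (t : nat) :
    S -> A -> R :=
  if t is t'.+1 then
    let phi := sgd_iter alpha phi0 y t' in
    fun s a => phi s a + alpha * grad (f (y t')) phi s a
  else phi0.

Lemma grad_coord_le y phi s a : `|grad (f y) phi s a| <= G.
Proof.
apply: le_trans (coord_le_norm _ s a) _.
by rewrite -[leRHS](ger0_norm G_ge0) -sqrtr_sqr ler_wsqrtr.
Qed.

(** Each partial derivative is the limit of difference quotients with step [1 / (n + 1)], which
    converge by [f_expansion]. *)
Lemma grad_measurable (d : measure_display) (W : measurableType d)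
    (phi : W -> S -> A -> R) (y : W -> Gamma) s a :
  (forall s a, measurable_fun [set: W] (fun w => phi w s a)) ->
  measurable_fun [set: W] y ->
  measurable_fun [set: W] (fun w => grad (f (y w)) (phi w) s a).
Proof.
move=> mphi my; pose u (n : nat) : R := n.+1%:R^-1.
pose e n s' a' := u n * unit_dir R (s, a) s' a'.
pose h n w := n.+1%:R * (f (y w) (fun s' a' => phi w s' a' + e n s' a') -
  f (y w) (phi w)).
apply: (@measurable_fun_cvg _ _ _ _ h) => [n|w _].
  apply: measurable_funM => //; apply: measurable_funB; last exact: f_measurable.
  apply: (@f_measurable _ _ (fun w s' a' => phi w s' a' + e n s' a')) => // s' a'.
  exact: measurable_funD.
pose c := H * sqnorm (unit_dir R (s, a)).
have c0 : 0 <= c by rewrite mulr_ge0 // sqnorm_ge0.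
apply/cvgrPdist_le => eps eps0.
have eps' : 0 < eps / (c + 1) by rewrite divr_gt0 //; lra.
near=> n.
have nu : n.+1%:R * u n = 1 by rewrite divff.
have u0 : 0 <= u n by rewrite invr_ge0.
rewrite (_ : grad (f (y w)) (phi w) s a - h n w = - (n.+1%:R *
  (f (y w) (fun s' a' => phi w s' a' + e n s' a') - f (y w) (phi w) -
   dotp (grad (f (y w)) (phi w)) (e n)))); last first.
  rewrite dotpZ dotp_unit mulrBr mulrA nu mul1r opprB; congr (_ - _).
rewrite normrN normrM ger0_norm //.
apply: le_trans (ler_wpM2l (ler0n _ n.+1) (f_expansion _ _ _)) _.
rewrite sqnormZ mulrCA expr2 -!mulrA (mulrA n.+1%:R) nu mul1r mulrCA -/c.
have un : u n <= eps / (c + 1).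
  by apply: ltW; near: n; exact: (near_infty_natSinv_lt (PosNum eps')).
apply: le_trans (ler_wpM2r c0 un) _.
rewrite mulrAC ler_pdivrMr; last lra.
by rewrite ler_wpM2l ?(ltW eps0) //; lra.
Unshelve. all: by end_near. Qed.

Let bmf phi : bounded_measurable (fun y => f y phi).
Proof.
split; first exact: (@f_measurable _ _ (fun=> phi) id).
by exists B => y; have /andP[f0 fB] := f_itv y phi; rewrite ger0_norm.
Qed.

Let bmg phi s a : bounded_measurable (fun y => grad (f y) phi s a).
Proof.
split; first exact: (@grad_measurable _ _ (fun=> phi) id).
by exists G => y; exact: grad_coord_le.
Qed.

Let bmdot phi v : bounded_measurable (fun y => dotp (grad (f y) phi) v).
Proof.
apply: bounded_measurable_sum => s; apply: bounded_measurable_sum => a.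
by apply: bounded_measurableM => //; exact: bounded_measurable_cst.
Qed.

Definition mean_grad (phi : S -> A -> R) s a : R :=
  avg mu (fun y => grad (f y) phi s a).

Lemma avg_dotp phi v :
  avg mu (fun y => dotp (grad (f y) phi) v) = dotp (mean_grad phi) v.
Proof.
have bm s a : bounded_measurable (fun y => grad (f y) phi s a * v s a).
  by apply: bounded_measurableM => //; exact: bounded_measurable_cst.
rewrite /dotp avg_sum => [|s]; last exact: bounded_measurable_sum.
apply: eq_bigr => s _; rewrite avg_sum //; apply: eq_bigr => a _.
by under eq_fun do rewrite mulrC; rewrite avgZ // mulrC.
Qed.

(** The remainder bound is the same for all tasks, so it survives averaging; this stands in for
    differentiation under the expectation. *)
Lemma mean_objective_expansion phi v :
  `|mean_objective (fun s a => phi s a + v s a) - mean_objective phi -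
    dotp (mean_grad phi) v| <= H * sqnorm v.
Proof.
rewrite /mean_objective !fine_expectation -avg_dotp -avgB // -avgB //; last first.
  exact: bounded_measurableB.
apply: avg_norm_le => //; apply: bounded_measurableB => //.
exact: bounded_measurableB.
Qed.

Lemma grad_mean_objective phi : grad mean_objective phi = mean_grad phi.
Proof. exact: grad_of_expansion (mean_objective_expansion phi). Qed.

Lemma mean_grad_le phi s a : `|mean_grad phi s a| <= G.
Proof. by apply: avg_norm_le => // y; exact: grad_coord_le. Qed.

Section Iterates.
Variables (alpha : R) (phi0 : S -> A -> R).

Let X t (w : Omega) := sgd_iter alpha phi0 (fun k => tau k w) t.

(** Only the draws before [t] have to be measurable, so the lemma applies on the history space as
    well as on [Omega]. *)
Lemma sgd_iter_measurable (d : measure_display) (W : measurableType d)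
    (y : nat -> W -> Gamma) t s a :
  (forall k, (k < t)%N -> measurable_fun [set: W] (y k)) ->
  measurable_fun [set: W] (fun w => sgd_iter alpha phi0 (y ^~ w) t s a).
Proof.
elim: t s a => [//|t IH] s a my /=.
have IHt s' a' : measurable_fun [set: W]
    (fun w => sgd_iter alpha phi0 (y ^~ w) t s' a').
  by apply: IH => k kt; apply: my; exact: ltnW.
apply: measurable_funD => //; apply: measurable_funM => //.
by apply: grad_measurable => //; exact: my.
Qed.

Let mX t s a : measurable_fun [set: Omega] (fun w => X t w s a).
Proof. by apply: (@sgd_iter_measurable _ _ tau) => k _; exact: measurable_funP. Qed.

Lemma mean_grad_measurable (d : measure_display) (W : measurableType d)
    (phi : W -> S -> A -> R) s a :
  (forall s a, measurable_fun [set: W] (fun w => phi w s a)) ->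
  measurable_fun [set: W] (fun w => mean_grad (phi w) s a).
Proof.
move=> mphi.
apply: (@measurable_avg _ _ _ _ _ mu (fun w y => grad (f y) (phi w) s a) G).
  apply: (@grad_measurable _ _ (fun x => phi x.1) snd) => // s' a'.
  exact: (measurableT_comp (mphi s' a')).
by move=> w y; exact: grad_coord_le.
Qed.

Lemma mean_objective_measurable (d : measure_display) (W : measurableType d)
    (phi : W -> S -> A -> R) :
  (forall s a, measurable_fun [set: W] (fun w => phi w s a)) ->
  measurable_fun [set: W] (fun w => mean_objective (phi w)).
Proof.
move=> mphi; under eq_fun do rewrite /mean_objective fine_expectation.
apply: (@measurable_avg _ _ _ _ _ mu (fun w y => f y (phi w)) B).
  apply: (@f_measurable _ _ (fun x => phi x.1) snd) => // s' a'.
  exact: (measurableT_comp (mphi s' a')).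
by move=> w y; have /andP[f0 fB] := f_itv y (phi w); rewrite ger0_norm.
Qed.

Lemma mean_objective_itv phi : 0 <= mean_objective phi <= B.
Proof.
rewrite /mean_objective fine_expectation; apply/andP; split.
  rewrite -(avg_cst mu 0); apply: avg_le => // [|y].
    exact: bounded_measurable_cst.
  by case/andP: (f_itv y phi).
rewrite -(avg_cst mu B); apply: avg_le => // [|y].
  exact: bounded_measurable_cst.
by case/andP: (f_itv y phi).
Qed.

Let bmF t : bounded_measurable (fun w => mean_objective (X t w)).
Proof.
split; first exact: mean_objective_measurable.
by exists B => w; have /andP[? ?] := mean_objective_itv (X t w); rewrite ger0_norm.
Qed.

Let bmgrad t s a : bounded_measurable (fun w => mean_grad (X t w) s a).
Proof.
split; first exact: mean_grad_measurable.
by exists G => w; exact: mean_grad_le.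
Qed.

Lemma sqnorm_mean_grad_bounded t :
  bounded_measurable (fun w => sqnorm (mean_grad (X t w))).
Proof.
apply: bounded_measurable_sum => s; apply: bounded_measurable_sum => a.
by under eq_fun do rewrite expr2; exact: bounded_measurableM.
Qed.

Let bmcross t :
  bounded_measurable (fun w => dotp (mean_grad (X t w)) (grad (f (tau t w)) (X t w))).
Proof.
apply: bounded_measurable_sum => s; apply: bounded_measurable_sum => a.
apply: bounded_measurableM => //; split.
  by apply: grad_measurable => //; exact: measurable_funP.
by exists G => w; exact: grad_coord_le.
Qed.

(** Given the past, the fresh gradient has mean [mean_grad]. To use [avg_independent], the iterate
    is regarded as a function [Y] on the history space. *)
Lemma avg_cross_term t :
  avg P (fun w => dotp (mean_grad (X t w)) (grad (f (tau t w)) (X t w))) =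
  avg P (fun w => sqnorm (mean_grad (X t w))).
Proof.
pose Y (w : history tau t) := sgd_iter alpha phi0 (fun k => tau k w) t.
have mY s a : measurable_fun [set: history tau t] (fun w => Y w s a).
  apply: (@sgd_iter_measurable _ _ (fun k (w : history tau t) => tau k w)) => k kt.
  exact: measurable_history_tau.
pose U (w : history tau t) y := dotp (mean_grad (Y w)) (grad (f y) (Y w)).
rewrite (@avg_independent _ _ _ _ _ mu P tau htau t U
  (\sum_(s : S) \sum_(a : A) G * G)).
- congr avg; apply/funext => w.
  rewrite -dotpp -avg_dotp; congr avg; apply/funext => y.
  by apply: eq_bigr => s _; apply: eq_bigr => a _; rewrite mulrC.
- apply: measurable_sum => s; apply: measurable_sum => a.
  apply: measurable_funM.
    apply: (@mean_grad_measurable _ _ (fun x => Y x.1)) => s' a'.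
    exact: (measurableT_comp (mY s' a')).
  apply: (@grad_measurable _ _ (fun x => Y x.1) snd) => // s' a'.
  exact: (measurableT_comp (mY s' a')).
- move=> w y; apply: le_trans (ler_norm_sum _ _ _) _; apply: ler_sum => s _.
  apply: le_trans (ler_norm_sum _ _ _) _; apply: ler_sum => a _.
  by rewrite normrM ler_pM ?mean_grad_le ?grad_coord_le.
Qed.

Lemma sgd_descent t :
  avg P (fun w => mean_objective (X t w)) +
    alpha * avg P (fun w => sqnorm (mean_grad (X t w))) -
    H * alpha ^+ 2 * G ^+ 2 <=
  avg P (fun w => mean_objective (X t.+1 w)).
Proof.
rewrite -avg_cross_term -avgZ // -avgD //; last exact: bounded_measurableZ.
rewrite -[X in _ - X](avg_cst P) -avgB //; last 2 first.
- by apply: bounded_measurableD => //; exact: bounded_measurableZ.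
- exact: bounded_measurable_cst.
apply: avg_le => // [|w].
  apply: bounded_measurableB; last exact: bounded_measurable_cst.
  by apply: bounded_measurableD => //; exact: bounded_measurableZ.
have := mean_objective_expansion (X t w)
  (fun s a => alpha * grad (f (tau t w)) (X t w) s a).
rewrite sqnormZ dotpZ ler_norml => /andP[+ _].
rewrite -[fun s a => _ + _]/(X t.+1 w) => He.
have : H * (alpha ^+ 2 * sqnorm (grad (f (tau t w)) (X t w))) <=
    H * alpha ^+ 2 * G ^+ 2.
  by rewrite -mulrA ler_wpM2l // ler_wpM2l ?sqr_ge0.
lra.
Qed.

(** The sum runs from 1 to [T], so the telescope ends at [F T.+1] and [F 1], both between 0 and
    [B]. *)
Lemma sgd_telescope T :
  alpha * \sum_(1 <= t < T.+1) avg P (fun w => sqnorm (mean_grad (X t w))) <=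
  B + T%:R * (H * alpha ^+ 2 * G ^+ 2).
Proof.
pose F t := avg P (fun w => mean_objective (X t w)).
pose N t := avg P (fun w => sqnorm (mean_grad (X t w))).
have F_itv t : 0 <= F t <= B.
  by apply/andP; split; [rewrite -[leLHS](avg_cst P) | rewrite -[leRHS](avg_cst P)];
    apply: avg_le => //; try exact: bounded_measurable_cst;
    move=> w; case/andP: (mean_objective_itv (X t w)).
have descent t : F t + alpha * N t - H * alpha ^+ 2 * G ^+ 2 <= F t.+1.
  exact: sgd_descent.
rewrite -/(\sum_(1 <= t < T.+1) N t); move: F N F_itv descent => F N F_itv descent.
suff : alpha * \sum_(1 <= t < T.+1) N t <=
    F T.+1 - F 1%N + T%:R * (H * alpha ^+ 2 * G ^+ 2).
  by have /andP[a0 _] := F_itv 1%N; have /andP[_ a1] := F_itv T.+1; lra.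
elim: T => [|T IH]; first by rewrite big_geq // mulr0 subrr mul0r addr0.
rewrite big_nat_recr //= mulrDr -natr1 mulrDl mul1r.
by have := descent T.+1; lra.
Qed.

End Iterates.
End StochasticGradientAscent.

(** * Inserting the step size *)

Section StepSizeArithmetic.
Variables (R : realType) (i : divergence) (gamma rmax Amax lambda : R).
Hypotheses (hgamma : 0 < gamma < 1) (hlambda : 0 < lambda).
Hypotheses (hrmax : 0 <= rmax) (hAmax : 0 <= Amax).

Let g := 1 - gamma.
Let g_gt0 : 0 < g. Proof. by rewrite /g subr_gt0; case/andP: hgamma. Qed.
Let g_le1 : g <= 1. Proof. by rewrite /g gerBl ltW //; case/andP: hgamma. Qed.
Let gammaE : gamma = 1 - g. Proof. by rewrite /g opprB addrC subrK. Qed.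

Lemma cstB_ge : 18 / g <= cstB i gamma rmax lambda.
Proof.
have b0 : 0 <= 16 * rmax / (lambda * g ^+ 3).
  by rewrite divr_ge0 ?mulr_ge0 ?exprn_ge0 ?(ltW g_gt0) // ltW.
have gV : 0 < g^-1 by rewrite invr_gt0.
case: i; rewrite /cstB -/g.
  have l0 : 0 < lambda^-1 by rewrite invr_gt0.
  by move: b0 gV l0; lra.
have : g^-1 <= (g ^+ 2)^-1 by rewrite lef_pV2 ?posrE ?exprn_gt0 // expr2 ler_piMr // ltW.
by move: b0; lra.
Qed.

Let cstBC := cstB i gamma rmax lambda + 2 * cstC i gamma ^+ 2.

Let cstB_gt0 : 0 < cstB i gamma rmax lambda.
Proof. by apply: lt_le_trans cstB_ge; rewrite divr_gt0. Qed.

Let u := g^-1.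
Let u_ge1 : 1 <= u.
Proof. by rewrite /u -invr1 lef_pV2 ?posrE. Qed.
Let u_gt0 : 0 < u. Proof. exact: lt_le_trans u_ge1. Qed.

(** Budget of the [1 / sqrt T] term. In [u = 1 / g >= 1] and up to the factor [rmax], the left side
    for [D1] is [u + 60 u^4 + 16 u^5] and the right side at least [18 u^5 + 72 u^6]; for [D2] they
    are [u + 2 u^4 + u^5] and [18 u^5 + 32 u^6]. *)
Lemma curvature_budget : rmax / g + smoothness i rmax gamma <= cstBC * rmax / g ^+ 4.
Proof.
have BCge : 18 * u + 2 * cstC i gamma ^+ 2 <= cstBC by rewrite lerD2r; exact: cstB_ge.
rewrite /smoothness -/g -!exprVn -/u.
have guE : gamma * u ^+ 5 = u ^+ 5 - u ^+ 4.
  have gu : g * u = 1 by rewrite divff // gt_eqF.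
  by rewrite gammaE mulrBl mul1r {2}(exprS u 4) mulrA gu mul1r.
rewrite (_ : rmax * u + _ = rmax * (u + curvature R i * u ^+ 4 +
    rate R i ^+ 2 * (gamma * u ^+ 5))); last by ring.
rewrite guE (_ : cstBC * rmax * _ = rmax * (cstBC * u ^+ 4)); last by ring.
rewrite ler_wpM2l //.
apply: le_trans (ler_wpM2r (exprn_ge0 4 (ltW u_gt0)) BCge).
have p1 : u <= u ^+ 6 by rewrite -{1}[u]expr1 ler_weXn2l.
have p4 : u ^+ 4 <= u ^+ 6 by rewrite ler_weXn2l.
have p5 : u ^+ 5 <= u ^+ 6 by rewrite ler_weXn2l.
have p0 : 0 <= u ^+ 5 by rewrite exprn_ge0 // ltW.
have CE : cstC i gamma = (match i with D1 => 6 | D2 => 4 end) * u by case: (i).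
rewrite CE mulrDl.
rewrite (_ : 18 * u * u ^+ 4 = 18 * u ^+ 5); last by ring.
rewrite (_ : 2 * (_ * u) ^+ 2 * u ^+ 4 =
  2 * (match i with D1 => 6 | D2 => 4 end) ^+ 2 * u ^+ 6); last by ring.
case: (i); rewrite /curvature /rate; lra.
Qed.

(* The minimum makes this bound vanish also when [rmax = 0]. When it vanishes, so
   do all gradients, and [step_size] is then [0] because of [0^-1 = 0]. *)
Definition grad_bound : R := rate R i * Num.min Amax (rmax / g) / g ^+ 2.

Lemma grad_bound_ge0 : 0 <= grad_bound.
Proof.
rewrite divr_ge0 ?sqr_ge0 // mulr_ge0 //; first by case: (i).
by rewrite le_min hAmax divr_ge0 // ltW.
Qed.

Lemma grad_bound_le : grad_bound <= cstG i gamma Amax.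
Proof.
rewrite (_ : cstG i gamma Amax =
  (match i with D1 => 4 | D2 => 2 end) * Amax / g ^+ 2); last by case: (i).
rewrite ler_wpM2r ?invr_ge0 ?sqr_ge0 //.
have : Num.min Amax (rmax / g) <= Amax by rewrite ge_min lexx.
by move: hAmax; case: (i); rewrite /rate; lra.
Qed.

Let BC_ge0 : 0 <= cstBC.
Proof. by rewrite addr_ge0 ?(ltW cstB_gt0) // mulr_ge0 // sqr_ge0. Qed.

Let G_ge0 : 0 <= cstG i gamma Amax := le_trans grad_bound_ge0 grad_bound_le.

Let L := rmax * cstB i gamma rmax lambda / g ^+ 2 +
  2 * gamma * rmax * cstC i gamma ^+ 2 / g ^+ 3.

(** Budget of the [1 / T] term: [L] is the inverse of the first candidate in [step_size]. *)
Lemma step_size_inv_budget : rmax / g * L <= cstK i gamma rmax lambda.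
Proof.
rewrite /cstK -/cstBC /L -/g -!exprVn -/u.
have u34 : u ^+ 3 <= u ^+ 4 by rewrite ler_weXn2l.
have u4 : 0 <= u ^+ 4 by rewrite exprn_ge0 // ltW.
have gle1 : gamma <= 1 by case/andP: hgamma => _ /ltW.
have C2 : 0 <= cstC i gamma ^+ 2 by exact: sqr_ge0.
rewrite (_ : rmax * u * _ = rmax ^+ 2 * (cstB i gamma rmax lambda * u ^+ 3 +
  2 * (gamma * (cstC i gamma ^+ 2 * u ^+ 4)))); last by ring.
rewrite (_ : 2 * cstBC * rmax ^+ 2 * u ^+ 4 =
  rmax ^+ 2 * (2 * (cstBC * u ^+ 4))); last by ring.
rewrite ler_wpM2l ?sqr_ge0 // /cstBC.
have h1 : cstB i gamma rmax lambda * u ^+ 3 <= cstB i gamma rmax lambda * u ^+ 4.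
  by rewrite ler_wpM2l // ltW.
have h2 : gamma * (cstC i gamma ^+ 2 * u ^+ 4) <= cstC i gamma ^+ 2 * u ^+ 4.
  by rewrite ler_piMl // mulr_ge0.
have h3 : 0 <= cstB i gamma rmax lambda * u ^+ 4 by rewrite mulr_ge0 // ltW.
have h4 : 0 <= cstC i gamma ^+ 2 * u ^+ 4 by rewrite mulr_ge0.
rewrite (_ : (_ + _) * u ^+ 4 = cstB i gamma rmax lambda * u ^+ 4 +
  2 * (cstC i gamma ^+ 2 * u ^+ 4)); last by ring.
move: (cstB _ _ _ _ * u ^+ 3) (cstB _ _ _ _ * u ^+ 4) (cstC i gamma ^+ 2 * u ^+ 4)
  (gamma * _) h1 h2 h3 h4.
by move=> x y z w; lra.
Qed.

(** Division by [alpha] splits the bound: [1 / alpha] is at most [L + G sqrt T], and in the noise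
    term [alpha <= 1 / (G sqrt T)] cancels one factor [G sqrt T]. The two budgets absorb the
    parts. *)
Lemma step_size_bound (T : nat) (N : R) : (0 < T)%N -> 0 <= N ->
  (grad_bound = 0 -> N = 0) ->
  let alpha := step_size i gamma rmax Amax lambda T in
  alpha * N <= rmax / g + T%:R * (smoothness i rmax gamma * alpha ^+ 2 * grad_bound ^+ 2) ->
  T%:R^-1 * N <= cstK i gamma rmax lambda / T%:R +
    cstM i gamma rmax Amax lambda / Num.sqrt T%:R.
Proof.
move=> T0 N0 NG alpha.
have T_gt0 : 0 < T%:R :> R by rewrite ltr0n.
set r := Num.sqrt T%:R; have r0 : 0 < r by rewrite sqrtr_gt0.
have Tr : T%:R = r ^+ 2 by rewrite sqr_sqrtr // ltW.
have Mge : (rmax / g + smoothness i rmax gamma) * cstG i gamma Amax <=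
    cstM i gamma rmax Amax lambda.
  rewrite (_ : cstM i gamma rmax Amax lambda =
    cstBC * rmax / g ^+ 4 * cstG i gamma Amax).
    by rewrite ler_wpM2r // curvature_budget.
  by rewrite /cstM -/cstBC -/g; ring.
(* Here [alpha] is 0 and cannot be divided by; but then [N = 0], and the right side is
   nonnegative. *)
have [G0|G0] := eqVneq grad_bound 0.
  move=> _; rewrite NG // mulr0 addr_ge0 // divr_ge0 ?(ltW r0) ?(ltW T_gt0) //.
    rewrite /cstK -/cstBC divr_ge0 ?mulr_ge0 ?sqr_ge0 ?exprn_ge0 ?(ltW g_gt0) //.
  rewrite /cstM -/cstBC divr_ge0 ?mulr_ge0 ?exprn_ge0 ?(ltW g_gt0) //.
have Gb_gt0 : 0 < grad_bound by rewrite lt_neqAle eq_sym G0 grad_bound_ge0.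
have Gc_gt0 : 0 < cstG i gamma Amax := lt_le_trans Gb_gt0 grad_bound_le.
have rmax_gt0 : 0 < rmax.
  rewrite lt_neqAle hrmax andbT; apply: contra_neq G0 => r00.
  by rewrite /grad_bound -r00 mul0r min_r // mulr0 mul0r.
have L0 : 0 < L.
  rewrite /L ltr_wpDr //; last first.
    by rewrite divr_gt0 ?exprn_gt0 // mulr_gt0.
  rewrite divr_ge0 ?exprn_ge0 ?(ltW g_gt0) // mulr_ge0 ?sqr_ge0 // mulr_ge0 //.
  by rewrite mulr_ge0 // ltW //; case/andP: hgamma.
have y0 : 0 < 1 / (cstG i gamma Amax * r) by rewrite divr_gt0 // mulr_gt0.
have alphaE : alpha = Num.min L^-1 (1 / (cstG i gamma Amax * r)) by [].
have alpha_gt0 : 0 < alpha by rewrite alphaE lt_min invr_gt0 L0.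
have alpha_le : alpha <= 1 / (cstG i gamma Amax * r) by rewrite alphaE ge_min lexx orbT.
(* The inverse of a minimum is the maximum of the inverses, bounded by their sum. *)
have alphaV : alpha^-1 <= L + cstG i gamma Amax * r.
  rewrite alphaE; case: (leP L^-1 (1 / (cstG i gamma Amax * r))) => _; first by rewrite invrK lerDl mulr_ge0 // ltW.
  by rewrite div1r invrK lerDr ltW.
move: alpha alphaE alpha_gt0 alpha_le alphaV => alpha _ alpha_gt0 alpha_le alphaV bound.
have H0 : 0 <= smoothness i rmax gamma.
  rewrite mulr_ge0 // addr_ge0 // divr_ge0 ?exprn_ge0 ?(ltW g_gt0) //.
    by case: (i).
  by rewrite mulr_ge0 ?sqr_ge0 // ltW //; case/andP: hgamma.
have rg0 : 0 <= rmax / g by rewrite divr_ge0 // ltW.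
have NL : N <= rmax / g * (L + cstG i gamma Amax * r) +
    smoothness i rmax gamma * cstG i gamma Amax * r.
  rewrite -(ler_pM2l alpha_gt0); apply: le_trans bound _; rewrite mulrDr.
  apply: lerD.
    rewrite mulrCA ler_peMr // -ler_pdivrMl ?mulr1 //.
  rewrite Tr (_ : r ^+ 2 * _ = alpha * (smoothness i rmax gamma *
    (alpha * (grad_bound ^+ 2 * r ^+ 2)))); last by ring.
  rewrite -mulrA ler_pM2l // ler_wpM2l //.
  have cGr : 0 < cstG i gamma Amax * r by rewrite mulr_gt0.
  have s1 : grad_bound ^+ 2 * r ^+ 2 <= (cstG i gamma Amax * r) ^+ 2.
    rewrite [leRHS]exprMn ler_wpM2r ?sqr_ge0 // lerXn2r ?nnegrE ?(ltW Gb_gt0) //.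
    exact: grad_bound_le.
  apply: le_trans (ler_wpM2l (ltW alpha_gt0) s1) _.
  have aX : alpha * (cstG i gamma Amax * r) <= 1 by rewrite -ler_pdivlMr.
  move: (cstG i gamma Amax * r) cGr aX => X X0 aX.
  by rewrite expr2 mulrA ler_piMl // ltW.
rewrite mulrC ler_pdivrMr //; apply: le_trans NL _.
rewrite mulrDl divfK ?gt_eqF // mulrDr -addrA; apply: lerD.
  exact: step_size_inv_budget.
rewrite (_ : cstM i gamma rmax Amax lambda / r * T%:R =
  cstM i gamma rmax Amax lambda * r); last by rewrite Tr; field; rewrite gt_eqF.
apply: le_trans (ler_wpM2r (ltW r0) Mge); rewrite le_eqVlt; apply/orP; left.
by apply/eqP; ring.
Qed.

End StepSizeArithmetic.

Theorem theorem1 (R : realType) (S A : finPointedType)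
  (dG : measure_display) (Gamma : measurableType dG) (mu : probability Gamma R)
  (dO : measure_display) (Omega : measurableType dO) (P : probability Omega R)
  (gamma rmax Amax lambda : R)
  (task : Gamma -> @mdp R S A rmax)
  (tau : nat -> {mfun Omega >-> Gamma})
  (i : divergence) (phi0 : S -> A -> R) (T : nat)
  (hgamma : 0 < gamma < 1)
  (hlambda : 0 < lambda)
  (hT : (0 < T)%N)
  (htask : measurable_tasks task)
  (htau : iid P mu tau)
  (A1 : forall (t : Gamma) (theta : S -> A -> R) (s : S) (a : A),
      `|advantage (task t) gamma (softmax theta) s a| <= Amax)
  (A2 : forall (t : Gamma) (b : R), exists2 eps : R, 0 < eps &
      forall phi : S -> A -> R, (forall s a, `|phi s a| <= b) ->
        forall s, eps <= visitation (task t) gamma (softmax phi) s)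
  (hlambdaA : 2 * Amax <= lambda) :
  let alpha := step_size i gamma rmax Amax lambda T in
  let phi (t : nat) (w : Omega) :=
    meta_iter task i gamma lambda alpha phi0 (fun k => tau k w) t in
  ((T%:R^-1)%:E * \sum_(1 <= t < T.+1)
     'E_P[fun w => sqnorm (grad (meta_objective task mu i gamma lambda) (phi t w))]
   <= (cstK i gamma rmax lambda / T%:R
       + cstM i gamma rmax Amax lambda / Num.sqrt T%:R)%R%:E)%E.
Proof.
lazy zeta; set alpha := step_size _ _ _ _ _ _.
pose phi t w := meta_iter task i gamma lambda alpha phi0 (fun k => tau k w) t.
(* [Gamma] is pointed, so some task witnesses [0 <= rmax]. *)
have rmax0 := rmax_ge0 (task point).
have Amax0 : 0 <= Amax.
  exact: le_trans (normr_ge0 _) (A1 point (fun _ _ => 0) point point).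
have g1' : 0 < 1 - gamma by rewrite subr_gt0; case/andP: hgamma.
pose f y phi := adapted_reward task i gamma lambda y phi.
pose G := grad_bound i gamma rmax Amax.
have G0 : 0 <= G := grad_bound_ge0 i hgamma rmax0 Amax0.
have H0 := smoothness_ge0 hgamma (task point) i.
have algd y th s : is_dist (alg i gamma lambda th (task y) s).
  rewrite (algE hgamma hlambda (A1 y) hlambdaA).
  exact: (alg_formula_dist hgamma hlambda (A1 y) hlambdaA).
have f_itv y th : 0 <= f y th <= rmax / (1 - gamma).
  by apply: total_reward_itv.
have f_expansion y th v :
    `|f y (fun s a => th s a + v s a) - f y th - dotp (grad (f y) th) v| <=
    smoothness i rmax gamma * sqnorm v.
  exact: (adapted_reward_expansion hgamma hlambda (A1 y) hlambdaA).
(* The adapted policy satisfies both advantage bounds, hence their minimum, which is what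
   [grad_bound] contains. *)
have f_grad y th : sqnorm (grad (f y) th) <= G ^+ 2.
  apply: (adapted_grad_le hgamma hlambda (A1 y) hlambdaA) => th' s a.
  rewrite le_min (alg_advantage_le hgamma hlambda (A1 y) hlambdaA) /=.
  apply: advantage_le => // s'.
  exact: (alg_formula_dist hgamma hlambda (A1 y) hlambdaA).
have f_meas (d : measure_display) (W : measurableType d)
    (th : W -> S -> A -> R) (y : W -> Gamma) :
    (forall s a, measurable_fun [set: W] (fun w => th w s a)) ->
    measurable_fun [set: W] y ->
    measurable_fun [set: W] (fun w => f (y w) (th w)).
  move=> mth my; have [mi mt mr] := htask.
  apply: (@measurable_total_reward _ _ _ _ _ _ _ hgamma (fun w => task (y w)))
    => [s|s a s'|s a s'|w s|s a].
  - exact: (measurableT_comp (mi s)).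
  - exact: (measurableT_comp (mt s a s')).
  - exact: (measurableT_comp (mr s a s')).
  - exact: algd.
  - under eq_fun => w do rewrite (algE hgamma hlambda (A1 (y w)) hlambdaA).
    exact: (@measurable_alg_formula _ _ _ _ _ _ _ _ hgamma (fun w => task (y w))
      (fun s' a' s'' => measurableT_comp (mt s' a' s'') my)
      (fun s' a' s'' => measurableT_comp (mr s' a' s'') my)
      th i s a Amax hlambda hlambdaA (fun w => A1 (y w)) mth).
have iterE t w : phi t w = sgd_iter f alpha phi0 (fun k => tau k w) t.
  by rewrite /phi; elim: t => [//|t IH] /=; rewrite IH.
have gradE th : grad (meta_objective task mu i gamma lambda) th = mean_grad mu f th.
  exact: (grad_mean_objective mu f_itv f_expansion G0 H0 f_grad f_meas).
pose N t := avg P (fun w => sqnorm (mean_grad mu f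
  (sgd_iter f alpha phi0 (fun k => tau k w) t))).
have NE t : ('E_P[fun w => sqnorm (grad (meta_objective task mu i gamma lambda)
    (phi t w))] = (N t)%:E)%E.
  under eq_fun do rewrite gradE iterE.
  apply: expectation_avg.
  exact: (sqnorm_mean_grad_bounded mu tau f_expansion G0 H0 f_grad f_meas).
rewrite (eq_bigr (fun t => (N t)%:E)); last by move=> t _; exact: NE.
rewrite sumEFin -EFinM lee_fin.
have N0 t : 0 <= N t.
  by apply: Rintegral_ge0 => w _; exact: sqnorm_ge0.
apply: (step_size_bound hgamma hlambda) => //.
- exact: sumr_ge0.
(* A zero gradient bound makes every coordinate of the mean gradient vanish. *)
- move=> G00; apply: big1 => t _.
  rewrite /N -(avg_cst P 0); congr avg; apply/funext => w.
  apply: big1 => s _; apply: big1 => a _.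
  have := mean_grad_le mu f_expansion G0 H0 f_grad f_meas
    (sgd_iter f alpha phi0 (fun k => tau k w) t) s a.
  by rewrite [G]G00 normr_le0 => /eqP ->; rewrite expr0n.
- exact: (sgd_telescope htau f_itv f_expansion G0 H0 f_grad f_meas).
Qed.
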